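(* Let $\tau$ be a face of $\mathcal{A}$ and let $C\subseteq X_\tau$ be a rational curve of degree $d$ that intersects the dense torus orbit of $X_\tau\subseteq X_\mathcal{A}$. 1. There exist $\ell\in\mathbb{N}$, a Cayley structure $\pi:\tau\to\Delta_\ell(d)$, a point $\mathbf{p}\in M_{0,\ell+1}$, and $t\in T_\tau$ such that $C=t\cdot C_{\pi,\mathbf{f}(\mathbf{p})}$. 2. The Cayley structure $\pi$ (of degree $d$) and $\mathbf{p}\in M_{0,\ell+1}$ are uniquely determined up to permutation by an element of the symmetric group $S_{\ell+1}$. 3. If $\ell>1$, there are only finitely many $t\in T_\tau$ such that $t\cdot C=C$.
   Context: **Toric varieties.** $\mathbb{K}$ is an algebraically closed field of characteristic zero, $M\cong\mathbb{Z}^n$ a lattice, $\mathcal{A}\subset M$ finite. $X_\mathcal{A}=\mathrm{Proj}\,\mathbb{K}[S_\mathcal{A}]\subseteq\mathbb{P}^{\#\mathcal{A}-1}$, where $S_\mathcal{A}\subset M\times\mathbb{Z}$ is the semigroup generated by $(u,1)$, $u\in\mathcal{A}$; homogeneous coordinates are $x_u$, $u\in\mathcal{A}$. A face $\tau$ of $\mathcal{A}$ is the intersection of $\mathcal{A}$ with a face of $\mathrm{conv}\,\mathcal{A}$ ($\mathcal{A}$ is a face of itself). $\langle\tau\rangle$ is the sublattice of $M$ generated by differences of elements of $\tau$, $T_\tau=\mathrm{Spec}\,\mathbb{K}[\langle\tau\rangle]$. $X_\tau\subseteq X_\mathcal{A}$ is embedded by $x_u=0$ for $u\notin\tau$; $T_\tau$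 acts on $X_\tau$ with $x_u$ of weight $u$, and the dense torus orbit of $X_\tau$ is the locus in $X_\tau$ where all $x_u$, $u\in\tau$, are nonzero. A rational curve is an integral curve with normalization $\mathbb{P}^1$. **Cayley structures.** $\Delta_\ell(d)=\{u\in\mathbb{Z}_{\geq0}^{\ell+1}: u_0+\dots+u_\ell=d\}$. A Cayley structure of length $\ell$ and degree $d$ on $\tau$ is a non-constant affine-linear map $\pi:\tau\to\Delta_\ell(d)$ such that for every $i\in\{0,\dots,\ell\}$ there are $w,w'\in\pi(\tau)$ with $w_i=0$ and $w'_i\neq0$. **Curves.** For a tuple $\mathbf{f}=(f_0,\dots,f_\ell)$ of nonzero linear forms in $\mathbb{K}[y_0,y_1]$ put $\mathbf{f}^v=\prod_i f_i^{v_i}$. $C_{\pi,\mathbf{f}}\subseteq X_\tau$ is the closure of the image of $\mathbb{P}^1\dashrightarrow X_\tau$, $y\mapsto(\mathbf{f}^{\pi(u)}(y))_{u\in\mathcal{A}}$ (coordinate $0$ for $u\notin\tau$). $M_{0,\ell+1}$ is the moduli space of $\ell+1$ distinct marked points on $\mathbb{P}^1$ up to automorphism (by convention $\mathrm{Spec}\,\mathbb{K}$ if $\ell=1$). For $\mathbf{p}=(P_0,\dots,P_\ell)\in M_{0,\ell+1}$ choose coordinates with $P_0=(1:0)$, $P_i=(c_i:1)$ for $i\ge1$, $c_1=0$, $c_2=1$, and put $\mathbf{f}(\mathbf{p})=(y_1,y_0,y_0-y_1,y_0-c_3y_1,\dots,y_0-c_\ell y_1)$ (just $(y_1,y_0)$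 if $\ell=1$). *)

(* Defs.v *)
From HB Require Import structures.
From mathcomp Require Import all_boot all_order all_fingroup all_algebra.
From mathcomp Require Export mpoly.

Set Implicit Arguments.
Unset Strict Implicit.
Unset Printing Implicit Defensive.

Import GRing.Theory.
Local Open Scope ring_scope.

(* Projective space P^(N-1) over an algebraically closed field K, through its
   K-points: a point is a nonzero row vector of homogeneous coordinates, taken
   up to [proj_eq], and a subset is the predicate of its representatives.
   Varieties (reduced closed subschemes) are identified with their point sets,
   [pclosed] ones in particular being stable under [proj_eq]. *)
Section ProjectiveSpace.
Variables (K : closedFieldType) (N : nat).

Definition pset := 'rV[K]_N -> Prop.

Definition pset_eq (C D : pset) : Prop := forall x, C x <-> D x.
Definition psubset (C D : pset) : Prop := forall x, C x -> D x.

Definition proj_eq (x y : 'rV[K]_N) : Prop := exists2 a : K, a != 0 & y = a *: x.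

Definition peval (F : {mpoly K[N]}) (x : 'rV[K]_N) : K := F.@[fun i => x 0 i].

Definition zero_locus (I : {mpoly K[N]} -> Prop) : pset := fun x =>
  x != 0 /\
  forall (k : nat) (F : {mpoly K[N]}), F \is k.-homog -> I F -> peval F x = 0.

Definition pclosed (C : pset) : Prop := exists I, pset_eq C (zero_locus I).

Definition pclosure (S : pset) : pset :=
  zero_locus (fun F => forall z, S z -> peval F z = 0).

Definition irreducible_pset (C : pset) : Prop :=
  (exists x, C x) /\
  forall D1 D2 : pset, pclosed D1 -> pclosed D2 ->
    (forall x, C x -> D1 x \/ D2 x) -> psubset C D1 \/ psubset C D2.

Definition is_point (C : pset) : Prop :=
  exists x, [/\ x != 0, C x & forall y, C y -> proj_eq x y].

(* Integral curve: closed, irreducible, of Krull dimension 1. *)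
Definition integral_curve (C : pset) : Prop :=
  [/\ pclosed C, irreducible_pset C, ~ is_point C &
      forall D : pset, pclosed D -> irreducible_pset D -> psubset D C ->
        is_point D \/ pset_eq D C].

(* The degree of a curve is the number of its points on a general hyperplane:
   general means that the coefficient vector h avoids the zero set of some
   nonzero polynomial B. *)
Definition hyperplane_section (C : pset) (h : 'rV[K]_N) : pset := fun x =>
  C x /\ \sum_(i < N) h 0 i * x 0 i = 0.

Definition card_points (S : pset) (d : nat) : Prop :=
  exists s : 'I_d -> 'rV[K]_N,
    [/\ forall i, S (s i),
        forall i j, proj_eq (s i) (s j) -> i = j &
        forall x, S x -> exists i, proj_eq (s i) x].

Definition curve_degree (C : pset) (d : nat) : Prop :=
  exists2 B : {mpoly K[N]}, B != 0 &
    forall h, peval B h != 0 -> card_points (hyperplane_section C h) d.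

End ProjectiveSpace.

Definition pmap (K : closedFieldType) (N : nat) (g : 'I_N -> {mpoly K[2]})
  (y : 'rV[K]_2) : 'rV[K]_N := \row_i peval (g i) y.

Section RationalCurves.
Variables (K : closedFieldType) (N : nat).
Implicit Type C : pset K N.

Definition pimage (g : 'I_N -> {mpoly K[2]}) : pset K N := fun x =>
  x != 0 /\ exists2 y : 'rV[K]_2, y != 0 & proj_eq (pmap g y) x.

(* Morphisms P^1 -> P^(N-1): forms of the same degree e without common zero. *)
Definition P1_morphism (e : nat) (g : 'I_N -> {mpoly K[2]}) : Prop :=
  (forall i, g i \is e.-homog) /\ (forall y, y != 0 -> pmap g y != 0).

(* Birationality of P^1 -> pimage g: there is a rational map (G 0 : G 1) from
   the image to P^1, given by forms of the same degree that do not both vanish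
   identically, whose composite with g is the identity where it is defined. *)
Definition birational_onto_image (g : 'I_N -> {mpoly K[2]}) : Prop :=
  exists (k : nat) (G : 'I_2 -> {mpoly K[N]}),
    [/\ forall i, G i \is k.-homog,
        exists y, y != 0 /\ exists i, peval (G i) (pmap g y) != 0 &
        forall y, peval (G 0) (pmap g y) * y 0 1
                  = peval (G 1) (pmap g y) * y 0 0].

(* The normalization of C is P^1: since P^1 is normal, this means that there is
   a finite birational morphism P^1 -> C. Finiteness is automatic for a
   birational morphism between complete curves. *)
Definition normalization_P1 C : Prop :=
  exists (e : nat) (g : 'I_N -> {mpoly K[2]}),
    [/\ P1_morphism e g, pset_eq C (pimage g) & birational_onto_image g].

Definition rational_curve C : Prop := integral_curve C /\ normalization_P1 C.

End RationalCurves.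

(* The finite set of lattice points is enumerated without repetition by
   A : 'I_N -> M = Z^n; subsets of it are given as sets of indices. *)
Section Faces.
Variables (R : realFieldType) (n N : nat) (A : 'I_N -> 'rV[int]_n).

Definition conv_hull (x : 'rV[R]_n) : Prop :=
  exists w : 'I_N -> R,
    [/\ forall i, 0 <= w i, \sum_i w i = 1 &
        x = \sum_i w i *: map_mx intr (A i)].

Definition face_of (P F : 'rV[R]_n -> Prop) : Prop :=
  exists (phi : 'cV[R]_n) (b : R),
    (forall x, P x -> (x *m phi) 0 0 <= b) /\
    (forall x, F x <-> P x /\ (x *m phi) 0 0 = b).

Definition is_face (tau : {set 'I_N}) : Prop :=
  exists2 F : 'rV[R]_n -> Prop, face_of conv_hull F &
    forall i, i \in tau <-> F (map_mx intr (A i)).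

End Faces.

Section Toric.
Variables (K : closedFieldType) (n N : nat) (A : 'I_N -> 'rV[int]_n).
Implicit Type tau : {set 'I_N}.

(* The element \sum_u m_u (u,1) of M x Z. *)
Definition mweight (m : 'X_{1..N}) : 'rV[int]_n * int :=
  (\sum_i A i *+ m i, (mdeg m)%:Z).

Definition supported_in tau (m : 'X_{1..N}) : bool :=
  [forall i, (m i != 0%N) ==> (i \in tau)].

(* The kernel of K[x_u : u \in A] -> K[S_tau] sending x_u to chi^(u,1) for u in
   tau and to 0 for the other u, i.e. the ideal of Proj K[S_tau] inside
   P^(N-1); the sum is the coefficient of chi^s in the image of F. *)
Definition toric_ideal tau (F : {mpoly K[N]}) : Prop :=
  forall s : 'rV[int]_n * int,
    \sum_(m <- msupp F | supported_in tau m && (mweight m == s)) F@_m = 0.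

(* X_A itself is [toric_variety setT]. *)
Definition toric_variety tau : pset K N := zero_locus (toric_ideal tau).

Definition dense_orbit tau : pset K N := fun x =>
  toric_variety tau x /\ forall i, i \in tau -> x 0 i != 0.

Definition in_lattice tau (v : 'rV[int]_n) : Prop :=
  exists c : 'I_N -> 'I_N -> int,
    v = \sum_(i in tau) \sum_(j in tau) (A i - A j) *~ c i j.

(* K-points of Spec K[<tau>], i.e. homomorphisms <tau> -> K^*. Only the values
   on <tau> are meaningful, whence [torus_eq]. *)
Record torus tau := Torus {
  tchar :> 'rV[int]_n -> K;
  tchar_neq0 : forall v, in_lattice tau v -> tchar v != 0;
  tcharD : forall v w, in_lattice tau v -> in_lattice tau w ->
    tchar (v + w) = tchar v * tchar w }.

Definition torus_eq tau (t t' : torus tau) : Prop :=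
  forall v, in_lattice tau v -> t v = t' v.

(* x_u has weight u; as u need not lie in <tau>, the weights are shifted by a
   base point i0 of tau, which does not affect the action on P^(N-1). *)
Definition tact tau (t : torus tau) (i0 : 'I_N) (x : 'rV[K]_N) : 'rV[K]_N :=
  \row_i (if i \in tau then t (A i - A i0) * x 0 i else 0).

Definition tact_set tau (t : torus tau) (C : pset K N) : pset K N := fun z =>
  exists i0 x, [/\ i0 \in tau, C x & proj_eq (tact t i0 x) z].

(* Affine-linearity of a map defined on tau only: it preserves all integral
   affine relations, equivalently is the restriction of an affine map from the
   affine lattice generated by tau. *)
Definition affine_on tau l (p : 'I_N -> {ffun 'I_l.+1 -> nat}) : Prop :=
  forall c : 'I_N -> int,
    \sum_(i in tau) c i = 0 -> \sum_(i in tau) A i *~ c i = 0 ->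
    forall j, \sum_(i in tau) c i * (p i j)%:Z = 0.

(* Only the values of p on tau are meaningful. *)
Definition Cayley_structure tau (l d : nat) (p : 'I_N -> {ffun 'I_l.+1 -> nat})
  : Prop :=
  [/\ forall i, i \in tau -> (\sum_j p i j)%N = d,
      affine_on tau p,
      exists i i', [/\ i \in tau, i' \in tau & p i <> p i'] &
      forall j, (exists2 i, i \in tau & p i j = 0%N) /\
                (exists2 i, i \in tau & p i j <> 0%N)].

Definition Cayley_map tau l (p : 'I_N -> {ffun 'I_l.+1 -> nat})
  (f : 'I_l.+1 -> {mpoly K[2]}) (i : 'I_N) : {mpoly K[2]} :=
  if i \in tau then \prod_j f j ^+ p i j else 0.

Definition Cayley_curve tau l (p : 'I_N -> {ffun 'I_l.+1 -> nat})
  (f : 'I_l.+1 -> {mpoly K[2]}) : pset K N :=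
  pclosure (pimage (Cayley_map tau p f)).

End Toric.

Section Moduli.
Variables (K : closedFieldType) (l : nat).
Implicit Types P Q : 'I_l.+1 -> 'rV[K]_2.

(* Points of M_(0,l+1) are represented by tuples of distinct points of P^1, and
   equality of points of M_(0,l+1) by [M0_eq]. *)
Definition marked_points P : Prop :=
  (forall i, P i != 0) /\ (forall i j, proj_eq (P i) (P j) -> i = j).

Definition M0_eq P Q : Prop :=
  exists2 g : 'M[K]_2, g \in unitmx & forall i, proj_eq (P i *m g) (Q i).

(* The tuple (1:0), (c_1:1), ..., (c_l:1); the entry c_0 is not used. *)
Definition std_points (c : 'I_l.+1 -> K) (i : 'I_l.+1) : 'rV[K]_2 :=
  \row_(j < 2) (if i == 0 then (j == 0)%:R else if j == 0 then c i else 1).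

Definition normal_coords P (c : 'I_l.+1 -> K) : Prop :=
  [/\ M0_eq P (std_points c),
      forall i : 'I_l.+1, i = 1%N :> nat -> c i = 0 &
      forall i : 'I_l.+1, i = 2%N :> nat -> c i = 1].

Definition std_forms (c : 'I_l.+1 -> K) (i : 'I_l.+1) : {mpoly K[2]} :=
  if i == 0 then 'X_(1 : 'I_2) else 'X_(0 : 'I_2) - c i *: 'X_(1 : 'I_2).

End Moduli.

(* C = t . C_(p, f(P)), with p a Cayley structure of length l and degree d on
   tau, P in M_(0,l+1) and t in T_tau. *)
Definition Cayley_presentation (K : closedFieldType) (n N : nat)
  (A : 'I_N -> 'rV[int]_n) (tau : {set 'I_N}) (C : pset K N) (d l : nat)
  (p : 'I_N -> {ffun 'I_l.+1 -> nat}) (P : 'I_l.+1 -> 'rV[K]_2)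
  (t : torus K A tau) : Prop :=
  [/\ Cayley_structure A tau d p, marked_points P &
      exists2 c : 'I_l.+1 -> K, normal_coords P c &
        pset_eq C (tact_set t (Cayley_curve tau p (std_forms c)))].

(* Main.v *)
Require Import Defs.
From mathcomp Require Import all_boot all_order all_fingroup all_algebra.
From mathcomp Require Import separable ring.
From Stdlib Require Import ClassicalEpsilon.

(** The curve C is the image of a morphism g from P^1 given by binary forms g i
    of the same degree, with a rational inverse. A general hyperplane section of
    C consists of the images of the zeros of a general combination of the g i.
    These zeros are simple and avoid the points where the inverse of g is not
    defined, so that the forms have degree d (curve_degree_parametrized).

    For the existence, let the marked points be all the zeros of the forms g i
    with i in tau. Each such form is a constant a i times the product of the
    linear forms of the marked points, with exponents p i of sum d. On C the
    binomials of the toric ideal vanish; comparing, for each affine relation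
    between the points of tau, the zero orders and then the constants on both
    sides of the binomial equation (toric_curve_relations), one finds that p is
    affine and that the a i are the values of a point of the torus. The g i have no
    common zero, which gives the coordinate with exponent 0 required of a Cayley
    structure at each marked point. It remains to choose coordinates on P^1 that
    normalize the marked points.

    The uniqueness and the finiteness rest on one lifting principle. If C is the
    closure of the image of forms phi of degree d, then phi factors through the
    normalization g, as g o (a : b) for forms a, b without common factor; as g and
    phi both have degree d, a and b are linear (birational_lift). Hence two
    presentations of C differ by a projectivity of P^1 and a constant on each
    coordinate. It matches the zeros of the coordinates, which are the marked
    points, and their orders, which are the exponents. Likewise, an element of
    the torus that maps C to itself acts on P^1 by a projectivity permuting the
    marked points; if there are at least three, the permutation determines the
    projectivity, and this one determines the element. *)

Set Implicit Arguments.
Unset Strict Implicit.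
Unset Printing Implicit Defensive.

Import GRing.Theory.
Local Open Scope ring_scope.

(* The map given by binary forms, rather than the partial map on sequences. *)
Local Notation pmap := Defs.pmap.

(** * Polynomials as functions over an infinite field *)

Lemma poly_nonroot (K : closedFieldType) (p : {poly K}) :
  p != 0 -> exists z, p.[z] != 0.
Proof. by case/closed_nonrootP=> z nz; exists z. Qed.

Lemma poly_funext (K : closedFieldType) (p q : {poly K}) :
  (forall z, p.[z] = q.[z]) -> p = q.
Proof.
move=> pq; apply/eqP; rewrite -subr_eq0; apply/negP=> /negP/poly_nonroot[z].
by rewrite hornerD hornerN pq subrr eqxx.
Qed.

Lemma closed_roots (K : closedFieldType) (p : {poly K}) :
  p != 0 -> exists r : seq K, forall z, root p z = (z \in r).
Proof.
move=> nzp; have [r pE] := closed_field_poly_normal p; exists r => z.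
by rewrite pE rootZ ?lead_coef_eq0 // root_prod_XsubC.
Qed.

Lemma base_digits_inj D n (a b : 'I_n -> nat) :
  (forall i, a i < D)%N -> (forall i, b i < D)%N ->
  (\sum_(i < n) a i * D ^ i = \sum_(i < n) b i * D ^ i)%N -> a =1 b.
Proof.
elim: n a b => [|n IHn] a b ltaD ltbD; first by move=> _ [].
have D_gt0 : (0 < D)%N by apply: leq_ltn_trans (ltaD ord0).
have shift (c : 'I_n.+1 -> nat) : (\sum_(i < n.+1) c i * D ^ i =
    (\sum_(i < n) c (lift ord0 i) * D ^ i) * D + c ord0)%N.
  rewrite big_ord_recl expn0 muln1 addnC big_distrl /=; congr addn.
  by apply: eq_bigr => i _; rewrite -mulnA -expnSr.
rewrite !shift => eqab i.
have eq0 : a ord0 = b ord0.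
  by move/(congr1 (modn^~ D)): eqab; rewrite !modnMDl !modn_small.
case: (unliftP ord0 i) => [j|] -> //.
apply: (IHn (a \o lift ord0) (b \o lift ord0)) => [k|k|] //=.
by move/eqP: eqab; rewrite eq0 eqn_add2r eqn_pmul2r // => /eqP.
Qed.

Lemma mpoly_subst_poly (K : closedFieldType) n (F : {mpoly K[n]})
    (u : 'I_n -> {poly K}) :
  exists p : {poly K}, forall z, p.[z] = F.@[fun i => (u i).[z]].
Proof.
exists (\sum_(m <- msupp F) F@_m *: \prod_i u i ^+ m i) => z.
rewrite mevalE horner_sum; apply: eq_bigr => m _.
rewrite hornerZ horner_prod; congr (_ * _).
by apply: eq_bigr => i _; rewrite horner_exp.
Qed.

(** Kronecker substitution: on the curve x_i = z^(D^i), where D exceeds all the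
    exponents of F, distinct monomials of F become distinct powers of z. *)
Lemma mpoly_nonroot (K : closedFieldType) n (F : {mpoly K[n]}) :
  F != 0 -> exists h : 'rV[K]_n, peval F h != 0.
Proof.
move=> nzF; have [m0 m0F] : exists m0, m0 \in msupp F.
  by exists (mlead F); apply: mlead_supp.
pose D := msize F; pose code (m : 'X_{1..n}) := (\sum_(i < n) m i * D ^ i)%N.
have code_inj m : m \in msupp F -> code m = code m0 -> m = m0.
  have digit m' i : m' \in msupp F -> (m' i < D)%N.
    move=> m'F; apply: leq_ltn_trans (msize_mdeg_lt m'F).
    by rewrite mdegE (bigD1 i) ?leq_addr.
  move=> mF eqc; apply/mnmP => i.
  by apply: (@base_digits_inj D _ m m0) => // j; apply: digit.
pose p : {poly K} := \sum_(m <- msupp F) F@_m *: 'X^(code m).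
have nzp : p != 0.
  move: (m0F); apply: contraTneq => p0; rewrite mcoeff_msupp negbK.
  have := congr1 (coefp (code m0)) p0; rewrite /= /p coef_sum coef0.
  rewrite (bigD1_seq m0) ?msupp_uniq ?m0F //= coefZ coefXn eqxx mulr1.
  rewrite big_seq_cond big1 ?addr0 => [/eqP // |m /andP[mF nem]].
  rewrite coefZ coefXn; case: eqP => [/esym /(code_inj _ mF) e|_].
    by rewrite e eqxx in nem.
  by rewrite mulr0.
have [z nz] := poly_nonroot nzp; exists (\row_i z ^+ (D ^ i)%N).
rewrite /peval mevalE; congr (_ != 0): nz; rewrite horner_sum.
apply: eq_bigr => m _; rewrite hornerZ hornerXn; congr (_ * _).
rewrite -prodrXr; apply: eq_bigr => i _.
by rewrite mxE -exprM mulnC.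
Qed.

Lemma peval_homogZ (K : closedFieldType) n k (F : {mpoly K[n]}) a x :
  F \is k.-homog -> peval F (a *: x) = a ^+ k * peval F x.
Proof.
move=> hF; rewrite /peval !mevalE big_distrr /= big_seq [RHS]big_seq.
apply: eq_bigr => m mF; rewrite mulrCA; congr (_ * _).
rewrite -(dhomog_mf hF mF) /= mdegE -prodrXr -big_split.
by apply: eq_bigr => i _; rewrite mxE exprMn.
Qed.

(** Torus elements act by diagonal maps; this is how homogeneous equations are
    pulled back along them. *)
Lemma homog_diag_subst (K : closedFieldType) n k (F : {mpoly K[n]})
    (w : 'I_n -> K) : F \is k.-homog ->
  exists2 G : {mpoly K[n]}, G \is k.-homog &
    forall x, peval G x = peval F (\row_i (w i * x 0 i)).
Proof.
move=> hF.
exists (\sum_(m <- msupp F) (F@_m * \prod_i w i ^+ m i) *: 'X_[m]).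
  rewrite big_seq; apply: rpred_sum => m mF; apply: rpredZ.
  by rewrite dhomogX (dhomog_mf hF mF).
move=> x; rewrite /peval raddf_sum mevalE; apply: eq_bigr => m _ /=.
rewrite mevalZ mevalX -mulrA -big_split; congr (_ * _).
by apply: eq_bigr => i _; rewrite mxE exprMn.
Qed.

Lemma peval_linear (K : closedFieldType) n (v h : 'rV[K]_n) :
  peval (\sum_i v 0 i *: 'X_i) h = \sum_i h 0 i * v 0 i.
Proof.
rewrite /peval raddf_sum; apply: eq_bigr => i _ /=.
by rewrite mevalZ mevalXU mulrC.
Qed.

Lemma row_neq0P (K : closedFieldType) N (v : 'rV[K]_N) :
  v != 0 -> exists i, v 0 i != 0.
Proof.
move=> nzv; apply/existsP; apply: contraR nzv; rewrite negb_exists => /forallP z.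
by apply/eqP/rowP=> i; rewrite mxE; move: (z i); rewrite negbK => /eqP.
Qed.

Lemma linear_mpoly_neq0 (K : closedFieldType) n (v : 'rV[K]_n) :
  v != 0 -> \sum_i v 0 i *: 'X_i != 0 :> {mpoly K[n]}.
Proof.
move=> /row_neq0P[i nzi]; apply: contraNneq nzi.
move=> /(congr1 (fun F => peval F (\row_j (j == i)%:R))).
rewrite peval_linear /peval meval0 => e; rewrite -[X in _ == X]e.
rewrite (bigD1 i) //= mxE eqxx mul1r big1 ?addr0 // => j /negbTE ne.
by rewrite mxE ne mul0r.
Qed.

(** For a nonzero vector v, the value at v of the linear form with coefficients h
    is a nonzero polynomial in h; the product of B and finitely many of these is
    nonzero somewhere. *)
Lemma general_hyperplane (K : closedFieldType) n (B : {mpoly K[n]})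
    (vs : seq 'rV[K]_n) : B != 0 -> (forall v, v \in vs -> v != 0) ->
  exists2 h, peval B h != 0 & forall v, v \in vs -> \sum_i h 0 i * v 0 i != 0.
Proof.
elim: vs B => [|v vs IHvs] B nzB nzvs.
  by have [h nzh] := mpoly_nonroot nzB; exists h.
have nzv : v != 0 by apply: nzvs; rewrite mem_head.
have [|w vsw|h] := IHvs (B * \sum_i v 0 i *: 'X_i).
- by rewrite mulf_neq0 ?linear_mpoly_neq0.
- by apply: nzvs; rewrite inE vsw orbT.
rewrite /peval mevalM mulf_eq0 => /norP[nzBh nzvh] hvs; exists h => // w.
by rewrite inE => /predU1P[->|/hvs //]; rewrite -peval_linear.
Qed.

(** * Points of the projective line and binary forms *)

Section ProjectiveEquality.
Variables (K : closedFieldType) (N : nat).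
Implicit Types x y z : 'rV[K]_N.

Lemma proj_eq_refl x : proj_eq x x.
Proof. by exists 1; rewrite ?oner_eq0 ?scale1r. Qed.

Lemma proj_eq_sym x y : proj_eq x y -> proj_eq y x.
Proof.
case=> a nza ->; exists a^-1; first by rewrite invr_eq0.
by rewrite scalerA mulVf ?scale1r.
Qed.

Lemma proj_eq_trans y x z : proj_eq x y -> proj_eq y z -> proj_eq x z.
Proof.
by case=> a nza -> [b nzb ->]; exists (b * a); rewrite ?mulf_neq0 ?scalerA.
Qed.

Lemma proj_eq_mulmx (M : 'M[K]_N) x y :
  proj_eq x y -> proj_eq (x *m M) (y *m M).
Proof. by case=> a nza ->; exists a; rewrite // -scalemxAl. Qed.

Lemma proj_eq_scale a x : a != 0 -> proj_eq x (a *: x).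
Proof. by exists a. Qed.

Lemma proj_eq_neq0 x y : proj_eq x y -> x != 0 -> y != 0.
Proof. by case=> a nza ->; rewrite scaler_eq0 negb_or nza. Qed.

End ProjectiveEquality.

Section BinaryForms.
Variable K : closedFieldType.
Implicit Types (x z a : K) (y Q : 'rV[K]_2) (q : {poly K}) (M : 'M[K]_2).

Definition pt x z : 'rV[K]_2 := \row_j (if j == 0 then x else z).

Lemma pt0 x z : pt x z 0 0 = x. Proof. by rewrite mxE. Qed.
Lemma pt1 x z : pt x z 0 1 = z. Proof. by rewrite mxE. Qed.

Lemma ord2_cases (i : 'I_2) : i = 0 \/ i = 1.
Proof. by case: i => -[|[|//]] lti; [left|right]; apply: val_inj. Qed.

Lemma row2P y y' : y 0 0 = y' 0 0 -> y 0 1 = y' 0 1 -> y = y'.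
Proof.
by move=> e0 e1; apply/rowP=> i; case: (ord2_cases i) => ->.
Qed.

Lemma pt_eta y : y = pt (y 0 0) (y 0 1).
Proof. by apply: row2P; rewrite mxE. Qed.

Lemma pt_finite_neq0 z : pt z 1 != 0.
Proof. by apply/eqP=> /rowP/(_ 1)/eqP; rewrite !mxE oner_eq0. Qed.

Lemma pt_infty_neq0 : pt 1 0 != 0.
Proof. by apply/eqP=> /rowP/(_ 0)/eqP; rewrite !mxE oner_eq0. Qed.

Lemma ptZ a x z : a *: pt x z = pt (a * x) (a * z).
Proof. by apply: row2P; rewrite !mxE. Qed.

Lemma pt_finite y : y 0 1 != 0 -> y = y 0 1 *: pt (y 0 0 / y 0 1) 1.
Proof. by move=> nz; rewrite ptZ mulr1 mulrC divfK // -pt_eta. Qed.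

Lemma pt_infty y : y 0 1 = 0 -> y = y 0 0 *: pt 1 0.
Proof. by move=> e; rewrite ptZ mulr1 mulr0 {1}[y]pt_eta e. Qed.

Lemma sum_ord2 (V : zmodType) (F : 'I_2 -> V) : \sum_i F i = F 0 + F 1.
Proof. by rewrite big_ord_recl big_ord1; congr (_ + F _); apply: val_inj. Qed.

Lemma pt_mulmx x z M :
  pt x z *m M = pt (x * M 0 0 + z * M 1 0) (x * M 0 1 + z * M 1 1).
Proof. by apply: row2P; rewrite !mxE sum_ord2 !mxE. Qed.

Lemma det_mx22 M : \det M = M 0 0 * M 1 1 - M 0 1 * M 1 0.
Proof.
rewrite (expand_det_row _ 0) sum_ord2 /cofactor !det_mx11 !mxE /= expr0 expr1.
have -> : lift 0 0 = 1 :> 'I_2 by apply: val_inj.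
have -> : lift 1 0 = 0 :> 'I_2 by apply: val_inj.
ring.
Qed.

(** The determinant of the rows y and Q; as a linear form in y, its zero is the
    point Q of P^1. *)
Definition wedge Q y := y 0 0 * Q 0 1 - y 0 1 * Q 0 0.

Lemma wedge_scale Q a y : wedge Q (a *: y) = a * wedge Q y.
Proof. rewrite /wedge !mxE; ring. Qed.

Lemma wedge_scalel Q a y : wedge (a *: Q) y = a * wedge Q y.
Proof. rewrite /wedge !mxE; ring. Qed.

Lemma wedge_eq0 Q y : Q != 0 -> y != 0 -> (wedge Q y = 0 <-> proj_eq Q y).
Proof.
move=> nzQ nzy; split; last first.
  by case=> a _ ->; rewrite wedge_scale /wedge; ring.
rewrite /wedge => /eqP; rewrite subr_eq0 => /eqP e.
have [Q1|nzQ1] := eqVneq (Q 0 1) 0.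
  have nzQ0 : Q 0 0 != 0.
    by apply: contraNneq nzQ => Q0; rewrite [Q]pt_eta Q0 Q1; apply/eqP/row2P;
      rewrite !mxE.
  have y1 : y 0 1 = 0.
    by apply/eqP; move/eqP: e; rewrite Q1 mulr0 eq_sym mulf_eq0 (negPf nzQ0) orbF.
  have nzy0 : y 0 0 != 0.
    by apply: contraNneq nzy => y0; rewrite [y]pt_eta y0 y1; apply/eqP/row2P;
      rewrite !mxE.
  exists (y 0 0 / Q 0 0); first by rewrite mulf_neq0 ?invr_eq0.
  by apply: row2P; rewrite !mxE ?divfK // Q1 y1 mulr0.
have nzy1 : y 0 1 != 0.
  apply: contraNneq nzy => y1; have y0 : y 0 0 = 0.
    by apply/eqP; move/eqP: e; rewrite y1 mul0r mulf_eq0 (negPf nzQ1) orbF.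
  by rewrite [y]pt_eta y0 y1; apply/eqP/row2P; rewrite !mxE.
exists (y 0 1 / Q 0 1); first by rewrite mulf_neq0 ?invr_eq0.
by apply: row2P; rewrite !mxE ?divfK // mulrAC -e mulfK.
Qed.

Lemma wedge_mulmx M Q y : wedge (Q *m M) (y *m M) = \det M * wedge Q y.
Proof.
rewrite (pt_eta Q) (pt_eta y) !pt_mulmx /wedge !pt0 !pt1 det_mx22; ring.
Qed.

Lemma mulmx_neq0 M y : M \in unitmx -> y != 0 -> y *m M != 0.
Proof. by move=> uM; apply: contraNneq => e; rewrite -(mulmxK uM y) e mul0mx. Qed.

Definition wprod l (Q : 'I_l -> 'rV[K]_2) (m : 'I_l -> nat) y :=
  \prod_j wedge (Q j) y ^+ m j.

Lemma wprod_neq0 l (Q : 'I_l -> 'rV[K]_2) m y :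
  (forall j, wedge (Q j) y != 0) -> wprod Q m y != 0.
Proof. by move=> nz; apply/prodf_neq0 => j _; rewrite expf_neq0. Qed.

Lemma wprod_expr l (Q : 'I_l -> 'rV[K]_2) m k y :
  wprod Q m y ^+ k = wprod Q (fun j => m j * k)%N y.
Proof. by rewrite -prodrXl; apply: eq_bigr => j _; rewrite exprM. Qed.

Lemma wprod_prod l (Q : 'I_l -> 'rV[K]_2) (I : finType) (P : pred I)
    (m : I -> 'I_l -> nat) y :
  \prod_(i | P i) wprod Q (m i) y = wprod Q (fun j => \sum_(i | P i) m i j)%N y.
Proof. by rewrite exchange_big; apply: eq_bigr => j _; rewrite prodrXr. Qed.

Lemma exp_factor_uniq (u v : {poly K}) m n :
  u.[0] != 0 -> v.[0] != 0 -> 'X^m * u = 'X^n * v -> m = n.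
Proof.
wlog ltmn : m n u v / (m <= n)%N => [sym nzu nzv e|nzu nzv e].
  case: (leqP m n) => [le|/ltnW le]; first exact: (sym m n u v).
  by apply/esym/(sym n m v u).
have := leq_eqVlt m n; rewrite ltmn => /esym/orP[/eqP //|lt].
have nzX : 'X^m != 0 :> {poly K} by rewrite expf_neq0 ?polyX_eq0.
have := mulfI nzX (_ : 'X^m * u = 'X^m * ('X^(n - m) * v)).
rewrite mulrA -exprD subnKC // => /(_ e) eu.
by case/eqP: nzu; rewrite eu hornerM hornerXn expr0n subn_eq0 leqNgt lt mul0r.
Qed.

(** The exponent of the point Q j is the order of vanishing at Q j, read off on
    an affine parametrization of P^1 centred at Q j. *)
Lemma wprod_uniq l (Q : 'I_l -> 'rV[K]_2) (m m' : 'I_l -> nat) c c' :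
  (forall j, Q j != 0) -> (forall i j, proj_eq (Q i) (Q j) -> i = j) ->
  c != 0 -> c' != 0 ->
  (forall y, y != 0 -> c * wprod Q m y = c' * wprod Q m' y) -> m =1 m'.
Proof.
move=> nzQ injQ nzc nzc' e j.
have [T nzT] : exists T, wedge (Q j) T != 0.
  have [Q1|nzQ1] := eqVneq (Q j 0 1) 0; last first.
    by exists (pt 1 0); rewrite /wedge pt0 pt1 mul0r subr0 mul1r.
  exists (pt 0 1); rewrite /wedge pt0 pt1 mul0r sub0r mul1r oppr_eq0.
  by apply: contraNneq (nzQ j) => Q0; rewrite [Q j]pt_eta Q0 Q1; apply/eqP/row2P;
    rewrite !mxE.
have wQ k z : wedge (Q k) (Q j + z *: T) =
    wedge (Q k) (Q j) + z * wedge (Q k) T.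
  by rewrite /wedge !mxE; ring.
have wQj : wedge (Q j) (Q j) = 0 by apply/wedge_eq0 => //; apply: proj_eq_refl.
pose lin k : {poly K} := (wedge (Q k) (Q j))%:P + 'X * (wedge (Q k) T)%:P.
pose rest (n : 'I_l -> nat) : {poly K} :=
  (wedge (Q j) T ^+ n j)%:P * \prod_(k | k != j) lin k ^+ n k.
have restE n z : ('X^(n j) * rest n).[z] = wprod Q n (Q j + z *: T).
  rewrite /wprod (bigD1 j) //= wQ wQj add0r exprMn -mulrA !hornerM hornerXn hornerC.
  rewrite horner_prod; congr (_ * (_ * _)); apply: eq_bigr => k _.
  by rewrite horner_exp wQ !hornerE.
have rest0 n : (rest n).[0] != 0.
  rewrite !hornerE horner_prod mulf_neq0 ?expf_neq0 //.
  apply/prodf_neq0 => k nekj; rewrite horner_exp !hornerE expf_neq0 //.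
  by apply: contraNneq nekj => /wedge_eq0 e0; apply/eqP/injQ/e0.
apply: (@exp_factor_uniq (c *: rest m) (c' *: rest m')).
- by rewrite hornerZ mulf_neq0.
- by rewrite hornerZ mulf_neq0.
apply: poly_funext => z; rewrite -!scalerAr !hornerZ !restE.
apply: e; apply: contraNneq (nzQ j) => y0.
have := congr1 (wedge (Q j)) y0.
rewrite wQ wQj add0r {2}/wedge !mxE !mul0r subr0 => /eqP.
rewrite mulf_eq0 (negPf nzT) orbF => /eqP z0.
by move: y0; rewrite z0 scale0r addr0 => ->.
Qed.

(** A binary form of degree e is encoded by its restriction q to the affine
    line y1 = 1, a polynomial of degree at most e. *)
Definition hval e q y := \sum_(k < e.+1) q`_k * (y 0 0 ^+ k * y 0 1 ^+ (e - k)).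

Lemma hval_finite e q z : (size q <= e.+1)%N -> hval e q (pt z 1) = q.[z].
Proof.
move=> leq_size; rewrite (horner_coef_wide _ leq_size).
by apply: eq_bigr => k _; rewrite pt0 pt1 expr1n mulr1.
Qed.

Lemma hval_infty e q : hval e q (pt 1 0) = q`_e.
Proof.
rewrite /hval big_ord_recr /= pt0 pt1 subnn expr1n mul1r mulr1 big1 ?add0r //.
by move=> k _; rewrite expr0n subn_eq0 leqNgt ltn_ord /= !mulr0.
Qed.

Lemma hval_scale e q a y : hval e q (a *: y) = a ^+ e * hval e q y.
Proof.
rewrite /hval big_distrr; apply: eq_bigr => k _; rewrite !mxE !exprMn.
have -> : a ^+ e = a ^+ k * a ^+ (e - k) by rewrite -exprD subnKC ?leq_ord.
by rewrite /=; ring.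
Qed.

Lemma hval_sum e (I : Type) (r : seq I) (c : I -> K) (q : I -> {poly K}) y :
  hval e (\sum_(i <- r) c i *: q i) y = \sum_(i <- r) c i * hval e (q i) y.
Proof.
rewrite /hval; under [RHS]eq_bigr do rewrite big_distrr.
rewrite exchange_big; apply: eq_bigr => k _ /=.
by rewrite coef_sum big_distrl; apply: eq_bigr => i _; rewrite coefZ mulrA.
Qed.

Lemma hval_Xn e k y : (k <= e)%N -> hval e 'X^k y = y 0 0 ^+ k * y 0 1 ^+ (e - k).
Proof.
move=> lek; rewrite /hval (bigD1 (inord k)) //= coefXn inordK // eqxx mul1r.
rewrite big1 ?addr0 // => j ne; rewrite coefXn; case: eqP => [e0|]; last first.
  by rewrite mul0r.
by case/eqP: ne; apply: val_inj; rewrite /= inordK.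
Qed.

Lemma homog_hval e (F : {mpoly K[2]}) : F \is e.-homog ->
  exists2 q : {poly K}, (size q <= e.+1)%N & forall y, peval F y = hval e q y.
Proof.
move=> hF; have degF m : m \in msupp F -> (m 0%R + m 1%R = e)%N.
  move/(dhomog_mf hF) => /= <-; rewrite mdegE big_ord_recl big_ord1.
  by congr (_ + m _)%N; apply: val_inj.
exists (\sum_(m <- msupp F) F@_m *: 'X^(m 0)).
  rewrite big_seq (leq_trans (size_sum _ _ _)) //; apply/bigmax_leqP_seq => m mF _.
  rewrite (leq_trans (size_scale_leq _ _)) // size_polyXn ltnS.
  by rewrite -(degF m mF) leq_addr.
move=> y; rewrite hval_sum /peval mevalE big_seq [RHS]big_seq.
apply: eq_bigr => m mF; congr (_ * _); rewrite -(degF m mF).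
rewrite hval_Xn ?leq_addr // addKn big_ord_recl big_ord1.
by rewrite (_ : lift _ _ = 1) //; apply: val_inj.
Qed.

(** Substitution of the forms (a, b) of degree m into a form of degree e, on
    the affine line. *)
Definition hcomp e q (a b : {poly K}) : {poly K} :=
  \sum_(k < e.+1) q`_k *: (a ^+ k * b ^+ (e - k)).

Lemma horner_hcomp e q (a b : {poly K}) z :
  (hcomp e q a b).[z] = hval e q (pt a.[z] b.[z]).
Proof.
rewrite horner_sum; apply: eq_bigr => k _.
by rewrite hornerZ hornerM !horner_exp pt0 pt1.
Qed.

Lemma coefM_top (a b : {poly K}) m n : (size a <= m.+1)%N -> (size b <= n.+1)%N ->
  (size (a * b)%R <= (m + n).+1)%N /\ (a * b)`_(m + n) = a`_m * b`_n.
Proof.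
move=> sa sb; split.
  apply: leq_trans (size_polyMleq _ _) _.
  by move: (leq_add sa sb); rewrite addSn addnS; case: (size a + size b)%N.
rewrite coefM (bigD1 (inord m)) //= inordK ?ltnS ?leq_addr // addKn.
rewrite big1 ?addr0 // => i ne; case: (ltngtP i m) => [lt|gt|eq].
- rewrite (@nth_default _ _ b) ?mulr0 //; apply: leq_trans sb _.
  by rewrite ltn_subRL ltn_add2r.
- by rewrite (@nth_default _ _ a) ?mul0r //; apply: leq_trans sa _.
by case/eqP: ne; apply: val_inj; rewrite /= inordK // ltnS leq_addr.
Qed.

Lemma coefX_top (a : {poly K}) m k : (size a <= m.+1)%N ->
  (size (a ^+ k)%R <= (k * m).+1)%N /\ (a ^+ k)`_(k * m) = a`_m ^+ k.
Proof.
move=> sa; elim: k => [|k [IHs IHc]]; first by rewrite mul0n !expr0 size_poly1 coef1.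
rewrite !exprS mulSn; have [s c] := coefM_top sa IHs.
by split; rewrite // c IHc.
Qed.

Lemma hcomp_top e q (a b : {poly K}) m :
  (size a <= m.+1)%N -> (size b <= m.+1)%N ->
  (size (hcomp e q a b) <= (e * m).+1)%N /\
  (hcomp e q a b)`_(e * m) = hval e q (pt a`_m b`_m).
Proof.
move=> sa sb.
have term (k : 'I_e.+1) : (size (a ^+ k * b ^+ (e - k))%R <= (e * m).+1)%N /\
    (a ^+ k * b ^+ (e - k))`_(e * m) = a`_m ^+ k * b`_m ^+ (e - k).
  have [sk ck] := coefX_top k sa; have [sk' ck'] := coefX_top (e - k) sb.
  have [s c] := coefM_top sk sk'; rewrite -mulnDl subnKC ?leq_ord // in s c.
  by rewrite s c ck ck'.
split.
  rewrite (leq_trans (size_sum _ _ _)) //; apply/bigmax_leqP => k _.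
  by rewrite (leq_trans (size_scale_leq _ _)) //; case: (term k).
rewrite coef_sum; apply: eq_bigr => k _; rewrite coefZ pt0 pt1.
by case: (term k) => _ ->.
Qed.

(** Restricting to the representatives (z, 1) and (1, 0) turns the equality of
    points into that of vectors, so that zeros can be counted in a sequence. *)
Definition normalized Q := (Q 0 1 == 1) || (Q == pt 1 0).

Lemma normalized_neq0 Q : normalized Q -> Q != 0.
Proof.
case/orP=> [/eqP e|/eqP->]; last exact: pt_infty_neq0.
by apply: contraTneq (oner_neq0 K) => Q0; rewrite -e Q0 mxE eqxx.
Qed.

Lemma normalized_inj Q Q' : normalized Q -> normalized Q' -> proj_eq Q Q' -> Q = Q'.
Proof.
move=> nQ nQ' [a nza eQ]; have := nQ'; rewrite eQ /normalized !mxE.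
case/orP: nQ => [/eqP Q1|/eqP->].
  rewrite Q1 mulr1 => /orP[/eqP->|/eqP]; first by rewrite scale1r.
  move/rowP/(_ 1)/eqP; rewrite !mxE Q1 mulr1 /= => /eqP a0.
  by rewrite a0 eqxx in nza.
rewrite mxE /= mulr0 eq_sym oner_eq0 /= => /eqP/rowP/(_ 0).
by rewrite !mxE /= mulr1 => ->; rewrite scale1r.
Qed.

(** The fundamental theorem of algebra for binary forms; the power of the
    variable y1 accounts for the root at infinity. *)
Lemma binary_form_factor e (F : {mpoly K[2]}) : F \is e.-homog ->
  (exists y, peval F y != 0) ->
  exists (s : seq 'rV[K]_2) (a : K),
    [/\ size s = e, forall Q, Q \in s -> normalized Q, a != 0 &
        forall y, peval F y = a * \prod_(Q <- s) wedge Q y].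
Proof.
move=> /homog_hval[q sq Fq] [y0 nz0].
have nzq : q != 0.
  apply: contraNneq nz0 => q0; rewrite Fq q0 /hval big1 // => k _.
  by rewrite coef0 mul0r.
have [r qr] := closed_field_poly_normal q.
have szq : size q = (size r).+1.
  by rewrite qr size_scale ?lead_coef_eq0 // size_prod_XsubC.
have ler : (size r <= e)%N by rewrite -ltnS -szq.
pose s := nseq (e - size r) (pt 1 0) ++ [seq pt z 1 | z <- r].
have sz_s : size s = e by rewrite size_cat size_nseq size_map subnK.
pose a := lead_coef q * (-1) ^+ (e - size r).
have prodE y : \prod_(Q <- s) wedge Q y =
    (- y 0 1) ^+ (e - size r) * \prod_(z <- r) (y 0 0 - y 0 1 * z).
  rewrite big_cat big_nseq iter_mulr_1 big_map; congr (_ ^+ _ * _).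
    by rewrite /wedge pt0 pt1 mulr0 mulr1 sub0r.
  by apply: eq_bigr => z _; rewrite /wedge pt0 pt1 mulr1.
have prodZ c y : \prod_(Q <- s) wedge Q (c *: y) =
    c ^+ e * \prod_(Q <- s) wedge Q y.
  under eq_bigr do rewrite wedge_scale.
  by rewrite big_split /= big_const_seq count_predT sz_s iter_mulr_1.
exists s, a; split=> [//|Q|//|y].
- rewrite mem_cat mem_nseq => /orP[/andP[_ /eqP->]|/mapP[z _ ->]].
    by rewrite /normalized eqxx orbT.
  by rewrite /normalized pt1 eqxx.
- by rewrite mulf_neq0 ?lead_coef_eq0 // expf_neq0 ?oppr_eq0 ?oner_eq0.
rewrite Fq; have [y1|nzy1] := eqVneq (y 0 1) 0.
  rewrite (pt_infty y1) hval_scale prodZ hval_infty mulrCA; congr (_ * _).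
  rewrite prodE pt0 pt1 oppr0 big1 ?mulr1 => [|z _]; last by rewrite mul0r subr0.
  have [le|lt] := leqP e (size r).
    rewrite /a (_ : (e - size r = 0)%N) ?expr0 ?mulr1; last first.
      by apply/eqP; rewrite subn_eq0.
    by rewrite lead_coefE szq /=; congr q`_ _; apply/eqP; rewrite eqn_leq le ler.
  by rewrite expr0n subn_eq0 leqNgt lt /= mulr0 nth_default // szq.
rewrite (pt_finite nzy1) hval_scale prodZ hval_finite // mulrCA; congr (_ * _).
rewrite prodE pt0 pt1 {1}qr hornerZ -mulrA; congr (_ * _).
rewrite mulrA -exprMn mulrNN mulr1 expr1n mul1r horner_prod.
by apply: eq_bigr => z _; rewrite hornerXsubC mul1r.
Qed.

Lemma prod_wedge_count (s : seq 'rV[K]_2) l (Q : 'I_l -> 'rV[K]_2) y :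
  injective Q -> (forall R, R \in s -> exists j, Q j = R) ->
  \prod_(R <- s) wedge R y = wprod Q (fun j => count_mem (Q j) s) y.
Proof.
move=> injQ; elim: s => [|R s IHs] coverQ.
  by rewrite big_nil /wprod big1.
rewrite big_cons IHs => [|R' sR']; last by apply: coverQ; rewrite inE sR' orbT.
have [j <-] := coverQ R (mem_head _ _).
rewrite /wprod (bigD1 j) //= [RHS](bigD1 j) //= eqxx mulrA -exprS.
congr (_ * _); apply: eq_bigr => k nekj.
by rewrite (inj_eq injQ) eq_sym (negPf nekj).
Qed.

End BinaryForms.

(** * Parametrized rational curves *)

Section ParametrizedCurves.
Variables (K : closedFieldType) (N : nat).
Implicit Types (g : 'I_N -> {mpoly K[2]}) (e k d : nat) (C : pset K N).

Lemma forms_hval e g : (forall i, g i \is e.-homog) ->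
  exists q : 'I_N -> {poly K}, (forall i, size (q i) <= e.+1)%N /\
    forall i y, peval (g i) y = hval e (q i) y.
Proof.
move=> hg; have [|q qP] := @fin_all_exists _ _ (fun i (q : {poly K}) =>
    (size q <= e.+1)%N /\ forall y, peval (g i) y = hval e q y).
  by move=> i; have [q] := homog_hval (hg i); exists q.
by exists q; split=> i; case: (qP i).
Qed.

Lemma pmap_scale e g a y : (forall i, g i \is e.-homog) ->
  pmap g (a *: y) = a ^+ e *: pmap g y.
Proof. by move=> hg; apply/rowP=> i; rewrite !mxE (peval_homogZ _ _ (hg i)). Qed.

Lemma pmap_proj_eq e g y z : (forall i, g i \is e.-homog) ->
  proj_eq y z -> proj_eq (pmap g y) (pmap g z).
Proof.
move=> hg [a nza ->]; exists (a ^+ e); first by rewrite expf_neq0.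
exact: pmap_scale.
Qed.

Lemma pmap_line_poly g (F : {mpoly K[N]}) (y v : 'rV[K]_2) :
  exists p : {poly K}, forall z, p.[z] = peval F (pmap g (y + z *: v)).
Proof.
have [|u uP] := @fin_all_exists _ _ (fun i (u : {poly K}) =>
    forall z, u.[z] = peval (g i) (y + z *: v)).
  move=> i; have [u uP] := mpoly_subst_poly (g i)
    (fun j => (y 0 j)%:P + (v 0 j)%:P * 'X).
  by exists u => z; rewrite uP; apply: meval_eq => j; rewrite !hornerE !mxE mulrC.
have [p pP] := mpoly_subst_poly F u.
by exists p => z; rewrite pP; apply: meval_eq => i; rewrite mxE uP.
Qed.

(** The line through y and y + (0, 1) leaves the locus y1 = 0, and F o g does not
    vanish identically on it. *)
Lemma pmap_nonzero_finite e k g (F : {mpoly K[N]}) :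
  (forall i, g i \is e.-homog) -> F \is k.-homog ->
  (exists y, peval F (pmap g y) != 0) ->
  exists z, peval F (pmap g (pt z 1)) != 0.
Proof.
move=> hg hF [y nz]; have [p pP] := pmap_line_poly g F y (pt 0 1).
have nzp : p * ((y 0 1)%:P + 'X) != 0.
  rewrite mulf_neq0 //.
    apply: contraNneq nz => p0; move: (pP 0).
    by rewrite p0 horner0 scale0r addr0 => <-.
  apply: contraNneq (oner_neq0 K) => /(congr1 (fun p : {poly K} => p`_1)).
  by rewrite coefD coefC coefX add0r coef0 => /eqP.
have [z] := poly_nonroot nzp; rewrite hornerM mulf_eq0 => /norP[nzpz nz1].
set w := y + z *: pt 0 1 in pP; have w1 : w 0 1 != 0.
  by rewrite !mxE /= mulr1; move: nz1; rewrite !hornerE.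
exists (w 0 0 / w 0 1); move: nzpz; rewrite pP -/w {1}(pt_finite w1).
by rewrite (pmap_scale _ _ hg) (peval_homogZ _ _ hF) mulf_eq0 => /norP[].
Qed.

Lemma pmap_affine_poly g (F : {mpoly K[N]}) :
  exists p : {poly K}, forall z, p.[z] = peval F (pmap g (pt z 1)).
Proof.
have [p pP] := pmap_line_poly g F (pt 0 1) (pt 1 0).
exists p => z; rewrite pP; congr (peval _ (pmap _ _)).
by apply: row2P; rewrite !mxE /= ?mulr1 ?mulr0 ?add0r ?addr0.
Qed.

(** Two pointwise proportional families of polynomials, each without common
    zero, differ by a constant. To see that f i0 divides u i0, replace one member
    of each family by a general combination, which is coprime to f i0. *)
Lemma proportional_families (f u : 'I_N -> {poly K}) :
  (forall z, \row_i (f i).[z] != 0) -> (forall z, \row_i (u i).[z] != 0) ->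
  (forall i j, f i * u j = f j * u i) ->
  exists2 c, c != 0 & forall i, u i = c *: f i.
Proof.
move=> nzf nzu prop.
have [i0 nzf0] : exists i, f i != 0.
  have [i] := row_neq0P (nzf 0); rewrite mxE => nzi; exists i.
  by apply: contraNneq nzi => ->; rewrite horner0.
have nzu0 : u i0 != 0.
  apply: contraNneq (nzu 0) => u0; apply/eqP/rowP=> i; rewrite !mxE.
  have /eqP := prop i0 i; rewrite u0 mulr0 mulf_eq0 (negPf nzf0) /= => /eqP->.
  by rewrite horner0.
have [rf rfE] := closed_roots nzf0; have [ru ruE] := closed_roots nzu0.
pose pt_of (v : 'I_N -> {poly K}) z : 'rV[K]_N := \row_i (v i).[z].
pose pts v r := [seq pt_of v z | z <- r].
have [|w|h _ hP] := @general_hyperplane K N 1 (pts f rf ++ pts u ru).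
- exact: oner_neq0.
- by rewrite mem_cat => /orP[]/mapP[z _ ->]; [apply: nzf | apply: nzu].
have combE (v : 'I_N -> {poly K}) z : (\sum_i h 0 i *: v i).[z] =
    \sum_i h 0 i * pt_of v z 0 i.
  by rewrite horner_sum; apply: eq_bigr => i _; rewrite hornerZ mxE.
have pts_mem v r z : z \in r -> pt_of v z \in pts v r by apply: map_f.
pose F := \sum_i h 0 i *: f i; pose U := \sum_i h 0 i *: u i.
have coF : coprimep (f i0) F.
  apply: Pdiv.ClosedField.root_coprimep => z; rewrite rfE => zr.
  by rewrite combE hP // mem_cat pts_mem.
have coU : coprimep (u i0) U.
  apply: Pdiv.ClosedField.root_coprimep => z; rewrite ruE => zr.
  by rewrite combE hP // mem_cat pts_mem ?orbT.
have propF : f i0 * U = F * u i0.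
  rewrite /F /U big_distrr big_distrl /=; apply: eq_bigr => i _.
  by rewrite -scalerAr -scalerAl prop.
have dvd1 : f i0 %| u i0 by rewrite -(Gauss_dvdpr _ coF) -propF dvdp_mulr.
have dvd2 : u i0 %| f i0 by rewrite -(Gauss_dvdpr _ coU) mulrC propF dvdp_mull.
have /eqpP[[c1 c2] /= /andP[nz1 nz2] e12] : f i0 %= u i0.
  by rewrite /eqp dvd1 dvd2.
have u0E : u i0 = (c1 / c2) *: f i0.
  by rewrite mulrC -scalerA e12 scalerA mulVf ?scale1r.
exists (c1 / c2) => [|i]; first by rewrite mulf_neq0 ?invr_eq0.
by apply: (mulfI nzf0); rewrite prop u0E -!scalerAr [f i * _]mulrC.
Qed.

(** The pair (a, b) has degree m, so it does not vanish at infinity when viewed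
    as a pair of binary forms of degree m. *)
Lemma coprime_top_neq0 (a b : {poly K}) :
  let m := (maxn (size a) (size b)).-1 in coprimep a b -> pt a`_m b`_m != 0.
Proof.
move=> m co_ab; apply/eqP=> e0.
have a0 := congr1 (fun y : 'rV[K]_2 => y 0 0) e0.
have b0 := congr1 (fun y : 'rV[K]_2 => y 0 1) e0; rewrite !mxE /= in a0 b0.
have [a00 b00] : a = 0 /\ b = 0.
  have [le|lt] := leqP (size a) (size b).
    have mE : m = (size b).-1 by rewrite /m (maxn_idPr le).
    have b00 : b = 0 by apply/eqP; rewrite -lead_coef_eq0 lead_coefE -mE b0.
    by split=> //; apply/eqP; rewrite -size_poly_leq0 (leq_trans le) // b00 size_poly0.
  have mE : m = (size a).-1 by rewrite /m (maxn_idPl (ltnW lt)).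
  have a00 : a = 0 by apply/eqP; rewrite -lead_coef_eq0 lead_coefE -mE a0.
  by move: lt; rewrite a00 size_poly0.
by move: co_ab; rewrite a00 b00 coprimep0 -size_poly_eq1 size_poly0.
Qed.

(** If phi maps P^1 into the image of g, then composing phi with the rational
    inverse G of g yields a map (a : b) from P^1 to itself with phi = g o (a : b),
    as a and b may be taken without common factor. Comparing the degrees of the
    forms defining phi and g o (a : b) shows that a and b are linear. *)
Lemma birational_lift e k g (G : 'I_2 -> {mpoly K[N]}) phi :
  (0 < e)%N -> P1_morphism e g -> (forall i, G i \is k.-homog) ->
  (forall y, peval (G 0) (pmap g y) * y 0 1 = peval (G 1) (pmap g y) * y 0 0) ->
  P1_morphism e phi ->
  (forall y, y != 0 -> exists2 w, w != 0 & proj_eq (pmap g w) (pmap phi y)) ->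
  (exists y i, peval (G i) (pmap phi y) != 0) ->
  exists (M : 'M[K]_2) (c : K), [/\ M \in unitmx, c != 0 &
    forall y, pmap phi y = c *: pmap g (y *m M)].
Proof.
move=> e_gt0 [hg nzg] hG invG [hphi nzphi] im_phi [y0 [i0 nzi0]].
have [q [sq qE]] := forms_hval hg; have [f [sf fE]] := forms_hval hphi.
have fE1 i z : (f i).[z] = peval (phi i) (pt z 1) by rewrite fE hval_finite.
have [psi psiE] := @fin_all_exists _ _ (fun i p => forall z,
  p.[z] = peval (G i) (pmap phi (pt z 1))) (fun i => pmap_affine_poly phi (G i)).
have nzpsi : (psi 0 != 0) || (psi 1 != 0).
  have [z] := pmap_nonzero_finite hphi (hG i0) (ex_intro _ y0 nzi0).
  rewrite -psiE; apply: contraR; rewrite negb_or !negbK => /andP[/eqP p0 /eqP p1].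
  by case: (ord2_cases i0) => ->; rewrite ?p0 ?p1 horner0.
pose D := gcdp (psi 0) (psi 1).
have nzD : D != 0 by rewrite gcdp_eq0 negb_and.
pose a : {poly K} := psi 0 %/ D; pose b : {poly K} := psi 1 %/ D.
have psi0 : psi 0 = a * D by rewrite divpK ?dvdp_gcdl.
have psi1 : psi 1 = b * D by rewrite divpK ?dvdp_gcdr.
have co_ab : coprimep a b by apply: coprimep_div_gcd.
have nzab z : pt a.[z] b.[z] != 0.
  apply/eqP=> e0; have a0 := congr1 (fun y : 'rV[K]_2 => y 0 0) e0.
  have b0 := congr1 (fun y : 'rV[K]_2 => y 0 1) e0; rewrite !mxE /= in a0 b0.
  have /(coprimep_root co_ab) : root a z by apply/eqP.
  by rewrite b0 eqxx.
(* The forms defining g o (a : b), on the affine line. *)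
pose gam i := hcomp e (q i) a b.
have gamE i z : (gam i).[z] = peval (g i) (pt a.[z] b.[z]).
  by rewrite horner_hcomp qE.
have prop i j : f i * gam j = f j * gam i.
  apply: (mulIf nzD); apply: poly_funext => z; rewrite !hornerM.
  have [-> | nzDz] := eqVneq D.[z] 0; first by rewrite !mulr0.
  have [w nzw [c nzc phiz]] := im_phi _ (pt_finite_neq0 z).
  have psiz i' : peval (G i') (pmap g w) = (c ^+ k)^-1 * (psi i').[z].
    by rewrite psiE phiz (peval_homogZ _ _ (hG i')) mulKf ?expf_neq0.
  have /(wedge_eq0 nzw (nzab z))[c' _ abE] : wedge w (pt a.[z] b.[z]) = 0.
    have := invG w; rewrite !psiz psi0 psi1 !hornerM -!mulrA => /mulfI.
    rewrite invr_eq0 expf_neq0 // => /(_ isT) eq_ab.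
    apply: (mulfI nzDz); rewrite mulr0.
    have -> : D.[z] * wedge w (pt a.[z] b.[z]) =
        a.[z] * (D.[z] * w 0 1) - b.[z] * (D.[z] * w 0 0).
      by rewrite /wedge pt0 pt1; ring.
    by rewrite eq_ab subrr.
  have phij j' : (f j').[z] = c * peval (g j') w.
    by rewrite fE1; move/rowP/(_ j'): phiz; rewrite !mxE.
  rewrite !phij !gamE abE !(peval_homogZ _ _ (hg _)); ring.
have [||c nzc gamc] := proportional_families _ _ prop => [z|z|].
- apply: contraNneq (nzphi _ (pt_finite_neq0 z)) => e0; apply/eqP/rowP=> i.
  by move/rowP/(_ i): e0; rewrite !mxE fE1.
- apply: contraNneq (nzg _ (nzab z)) => e0; apply/eqP/rowP=> i.
  by move/rowP/(_ i): e0; rewrite !mxE gamE.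
pose m := (maxn (size a) (size b)).-1.
have size_le (p : {poly K}) : (size p <= maxn (size a) (size b))%N ->
    (size p <= m.+1)%N by move/leq_trans; apply; apply: leqSpred.
have sa : (size a <= m.+1)%N by apply: size_le; rewrite leq_maxl.
have sb : (size b <= m.+1)%N by apply: size_le; rewrite leq_maxr.
have em : (e * m = e)%N.
  apply/eqP; rewrite eqn_leq; apply/andP; split.
    have [i] := row_neq0P (nzg _ (coprime_top_neq0 co_ab)); rewrite mxE qE => nzi.
    have [_ top] := hcomp_top e (q i) sa sb; rewrite -top -/(gam i) gamc in nzi.
    rewrite -ltnS; apply: leq_trans (sf i); rewrite ltnNge.
    by apply: contraNN nzi => le; rewrite coefZ nth_default ?mulr0.
  have [i] := row_neq0P (nzphi _ (pt_infty_neq0 K)); rewrite mxE fE hval_infty => nzi.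
  have [szg _] := hcomp_top e (q i) sa sb.
  rewrite -ltnS; apply: leq_trans szg; rewrite -/(gam i) ltnNge.
  apply: contraNN nzi => le; have := nth_default 0 le.
  by rewrite gamc coefZ => /eqP; rewrite mulf_eq0 (negPf nzc).
have m1 : m = 1%N by apply/eqP; rewrite -(eqn_pmul2l e_gt0) em muln1.
rewrite m1 in sa sb.
pose M : 'M[K]_2 := \matrix_(i, j)
  (if i == 0 then (if j == 0 then a`_1 else b`_1) else if j == 0 then a`_0 else b`_0).
have linE (p : {poly K}) z : (size p <= 2)%N -> p.[z] = z * p`_1 + p`_0.
  move=> sp; rewrite (horner_coef_wide _ sp) sum_ord2 /= mulr1 addrC.
  by rewrite mulrC.
have phiE y : pmap phi y = c^-1 *: pmap g (y *m M).
  apply/rowP=> i; rewrite !mxE; apply: (mulfI nzc); rewrite mulVKf //.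
  have [y1|nzy1] := eqVneq (y 0 1) 0.
    rewrite (pt_infty y1) -scalemxAl !(peval_homogZ _ _ (hphi _)).
    rewrite (peval_homogZ _ _ (hg _)) mulrCA; congr (_ * _).
    rewrite fE hval_infty -coefZ -gamc.
    have [_] := hcomp_top e (q i) sa sb; rewrite muln1 => ->.
    by rewrite qE pt_mulmx !mxE /= !mul1r !mul0r !addr0.
  rewrite (pt_finite nzy1) -scalemxAl !(peval_homogZ _ _ (hphi _)).
  rewrite (peval_homogZ _ _ (hg _)) mulrCA; congr (_ * _).
  by rewrite -fE1 -hornerZ -gamc gamE pt_mulmx !mxE /= !mul1r -!linE.
exists M, c^-1; split=> //; last by rewrite invr_eq0.
rewrite unitmxE unitfE; apply/negP=> /det0P[v nzv vM].
have g0 : pmap g 0 = 0.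
  rewrite -(scale0r (pt 1 0)) (pmap_scale _ _ hg) expr0n gtn_eqF //.
  by rewrite scale0r.
by have := nzphi v nzv; rewrite phiE vM g0 scaler0 eqxx.
Qed.

End ParametrizedCurves.

(** * The degree of a parametrized curve *)

Section Degree.
Variables (K : closedFieldType) (N : nat).
Implicit Types (g : 'I_N -> {mpoly K[2]}) (e k d : nat) (C : pset K N).

(** A constant map has no rational inverse. *)
Lemma birational_degree_gt0 e g :
  (forall i, g i \is e.-homog) -> birational_onto_image g -> (0 < e)%N.
Proof.
move=> hg [k [G [_ [y [_ [i nzi]]] invG]]]; rewrite lt0n.
apply: contraNneq nzi => e0; rewrite e0 in hg.
have const z z' : pmap g z = pmap g z'.
  have [q [_ qE]] := forms_hval hg; apply/rowP=> j; rewrite !mxE !qE.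
  by rewrite /hval !big_ord1 !subn0 !expr0.
have := invG (pt 1 0); have := invG (pt 0 1).
rewrite !pt0 !pt1 !mulr1 !mulr0 (const (pt 0 1) y) (const (pt 1 0) y) => G0 G1.
by case: (ord2_cases i) => ->; rewrite ?G0 -?G1.
Qed.

Lemma card_points_le (S : pset K N) d d' :
  card_points S d -> card_points S d' -> (d <= d')%N.
Proof.
move=> [s [Ss injs _]] [s' [_ _ covers']].
have [f fP] := @fin_all_exists _ _ (fun i j => proj_eq (s' j) (s i))
  (fun i => covers' _ (Ss i)).
rewrite -(card_ord d) -(card_ord d'); apply: (@leq_card _ _ f) => i i' eqf.
apply: injs; apply: proj_eq_trans (fP i').
by rewrite -eqf; apply: proj_eq_sym.
Qed.

Lemma card_points_uniq (S : pset K N) d d' :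
  card_points S d -> card_points S d' -> d = d'.
Proof. by move=> Sd Sd'; apply/eqP; rewrite eqn_leq !(@card_points_le S). Qed.

Lemma wronskian_neq0 (f0 f1 : {poly K}) : [pchar K] =i pred0 ->
  (1 < size f0)%N -> coprimep f0 f1 -> f0 * f1^`() - f1 * f0^`() != 0.
Proof.
move=> charK sz co; rewrite subr_eq0; apply/negP=> /eqP eqW.
have dvd : f0 %| f0^`() by rewrite -(Gauss_dvdpr _ co) -eqW dvdp_mulr.
have nz : f0 != 0 by rewrite -size_poly_gt0 (ltn_trans _ sz).
have d0 : f0^`() = 0.
  apply/eqP; apply: contraLR dvd => nzd; apply/negP=> /(dvdp_leq nzd).
  by rewrite leqNgt lt_size_deriv.
move/(congr1 (fun p : {poly K} => p`_(size f0).-2)): d0.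
rewrite coef_deriv coef0 prednK; last by rewrite -subn1 subn_gt0.
move/eqP; rewrite -mulr_natr mulf_eq0 -lead_coefE lead_coef_eq0 (negPf nz) /=.
by rewrite -subn1 ((pcharf0P K).1 charK) subn_eq0 leqNgt sz.
Qed.

(** In a pencil f0 + s f1 of coprime polynomials, a multiple root is a zero of
    the Wronskian of f0 and f1, and each point is a root of at most one member:
    hence all but finitely many members are separable. Likewise the zeros of
    bad can be avoided. *)
Lemma general_pencil_member (f0 f1 beta bad : {poly K}) e :
  [pchar K] =i pred0 -> (0 < e)%N ->
  (size f0 <= e.+1)%N -> (size f1 <= e.+1)%N -> f0`_e != 0 ->
  coprimep f0 f1 -> beta != 0 -> bad != 0 ->
  exists s, [/\ beta.[s] != 0, (f0 + s *: f1)`_e != 0 &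
    exists r, [/\ size r = e, uniq r, forall z, root (f0 + s *: f1) z = (z \in r) &
                  forall z, z \in r -> bad.[z] != 0]].
Proof.
move=> charK e_gt0 sz0 sz1 nzf0e co nzbeta nzbad.
have szf0 : size f0 = e.+1.
  apply/eqP; rewrite eqn_leq sz0 ltnNge.
  by apply: contraNN nzf0e => le; rewrite nth_default.
have nzW : f0 * f1^`() - f1 * f0^`() != 0.
  by apply: wronskian_neq0 => //; rewrite szf0.
set W := (_ - _) in nzW.
have [rb rbE] := closed_roots (mulf_neq0 nzW nzbad).
pose avoid z : {poly K} := (f0.[z])%:P + (f1.[z])%:P * 'X.
have nz_lin (c0 c1 : K) : ~~ ((c0 == 0) && (c1 == 0)) ->
    c0%:P + c1%:P * 'X != 0 :> {poly K}.
  apply: contraNneq => e0; have := congr1 (fun p : {poly K} => p`_0) e0.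
  have := congr1 (fun p : {poly K} => p`_1) e0.
  rewrite !coefD !coefCM !coefX !coefC !mulr1 !mulr0 addr0 add0r /= => -> ->.
  by rewrite eqxx.
have [s] : exists s, (beta * ((f0`_e)%:P + (f1`_e)%:P * 'X) *
    \prod_(z <- rb) avoid z).[s] != 0.
  apply: poly_nonroot; rewrite !mulf_neq0 ?nz_lin ?(negPf nzf0e) //.
  rewrite prodf_seq_neq0; apply/allP=> z _ /=; apply: nz_lin.
  by apply/negP=> /andP[/(coprimep_root co)/negPf->].
rewrite !hornerM !mulf_eq0 !negb_or => /andP[/andP[nzs nzes] nzprod].
have nze : (f0 + s *: f1)`_e != 0.
  by move: nzes; rewrite !hornerE coefD coefZ mulrC.
pose f := f0 + s *: f1.
have szf : size f = e.+1.
  apply/eqP; rewrite eqn_leq ltnNge; apply/andP; split.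
    rewrite (leq_trans (size_polyD _ _)) // geq_max sz0.
    by rewrite (leq_trans (size_scale_leq _ _)).
  by apply: contraNN nze => le; rewrite nth_default.
have nzf : f != 0 by rewrite -size_poly_gt0 szf.
have rb_avoid z : root f z -> (W * bad).[z] != 0.
  move=> /eqP fz; apply/negP=> Wz; move: nzprod.
  rewrite horner_prod prodf_seq_neq0 => /allP/(_ z).
  rewrite -rbE rootE Wz => /(_ isT); rewrite /= !hornerE.
  by move: fz; rewrite !hornerE mulrC => ->; rewrite eqxx.
exists s; split=> //; have [r rE] := closed_field_poly_normal f.
have nzl : lead_coef f != 0 by rewrite lead_coef_eq0.
have rootr z : root f z = (z \in r).
  by rewrite rE rootZ // root_prod_XsubC.
exists r; split=> //; last 1 first.
- by move=> z; rewrite -rootr => /rb_avoid; rewrite hornerM mulf_eq0 => /norP[].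
- by apply/eqP; rewrite -eqSS -szf rE size_scale // size_prod_XsubC.
rewrite -separable_prod_XsubC unlock.
apply: Pdiv.ClosedField.root_coprimep => z; rewrite root_prod_XsubC -rootr => fz.
have := rb_avoid z fz; rewrite hornerM mulf_eq0 => /norP[+ _].
apply: contraNneq => dz; have df : f^`().[z] = 0.
  by rewrite rE derivZ hornerZ dz mulr0.
move/eqP: fz; move: df; rewrite /f derivD derivZ !hornerE => df fz.
have -> : f0.[z] = - (s * f1.[z]) by apply/eqP; rewrite -addr_eq0 fz.
have -> : f0^`().[z] = - (s * f1^`().[z]) by apply/eqP; rewrite -addr_eq0 df.
by apply/eqP; ring.
Qed.

(** A general hyperplane cuts the curve in the images of the zeros of a general
    combination of the forms g i; these zeros are simple, and g is injective on
    them because the rational inverse of g is defined there. *)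
Lemma curve_degree_parametrized e g C d : [pchar K] =i pred0 ->
  P1_morphism e g -> birational_onto_image g -> pset_eq C (pimage g) ->
  curve_degree C d -> d = e.
Proof.
move=> charK [hg nzg] birg Cg [B nzB degB].
have e_gt0 := birational_degree_gt0 hg birg.
have [k [G [hG [y [_ [i nzi]]] invG]]] := birg.
have [q [sq qE]] := forms_hval hg.
have qE1 j z : (q j).[z] = peval (g j) (pt z 1) by rewrite qE hval_finite.
pose comb (h : 'rV[K]_N) : {poly K} := \sum_j h 0 j *: q j.
have sz_comb h : (size (comb h) <= e.+1)%N.
  rewrite (leq_trans (size_sum _ _ _)) //; apply/bigmax_leqP => j _.
  by rewrite (leq_trans (size_scale_leq _ _)).
have combE h z : (comb h).[z] = \sum_j h 0 j * pmap g (pt z 1) 0 j.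
  by rewrite horner_sum; apply: eq_bigr => j _; rewrite hornerZ qE1 mxE.
have comb_infty h : (comb h)`_e = \sum_j h 0 j * pmap g (pt 1 0) 0 j.
  by rewrite coef_sum; apply: eq_bigr => j _; rewrite coefZ mxE qE hval_infty.
have [v|h0 nzBh0 h0P] := @general_hyperplane K N B [:: pmap g (pt 1 0)] nzB.
  by rewrite inE => /eqP->; apply: nzg; apply: pt_infty_neq0.
have nzh0e : (comb h0)`_e != 0 by rewrite comb_infty h0P ?mem_head.
have nzh0 : comb h0 != 0 by apply: contraNneq nzh0e => ->; rewrite coef0.
have [r0 r0E] := closed_roots nzh0.
have [|v|h1 _ h1P] := @general_hyperplane K N 1 [seq pmap g (pt z 1) | z <- r0].
- exact: oner_neq0.
- by case/mapP=> z _ ->; apply: nzg; apply: pt_finite_neq0.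
have co : coprimep (comb h0) (comb h1).
  apply: Pdiv.ClosedField.root_coprimep => z; rewrite r0E => zr.
  by rewrite combE h1P // (map_f (fun z => pmap g (pt z 1)) zr).
have [z0 nzz0] := pmap_nonzero_finite hg (hG i) (ex_intro _ y nzi).
have [bad badE] := pmap_affine_poly g (G i).
have nzbad : bad != 0.
  by apply: contraNneq nzz0 => b0; rewrite -badE b0 horner0.
have [beta betaP] := mpoly_subst_poly B
  (fun j => (h0 0 j)%:P + (h1 0 j)%:P * 'X).
have betaE s : beta.[s] = peval B (h0 + s *: h1).
  by rewrite betaP; apply: meval_eq => j; rewrite !hornerE !mxE mulrC.
have nzbeta : beta != 0.
  apply: contraNneq nzBh0 => b0; rewrite -[h0]addr0 -(scale0r h1) -betaE b0.
  by rewrite horner0.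
have [s [nzs nze [r [sz_r uniq_r rootr badr]]]] := general_pencil_member charK
  e_gt0 (sz_comb h0) (sz_comb h1) nzh0e co nzbeta nzbad.
pose h := h0 + s *: h1.
have combh : comb h0 + s *: comb h1 = comb h.
  rewrite /comb scaler_sumr -big_split; apply: eq_bigr => j _.
  by rewrite !mxE scalerDl scalerA.
rewrite combh in nze; have {}rootr z : root (comb h) z = (z \in r).
  by rewrite -rootr combh.
apply: (@card_points_uniq (hyperplane_section C h)).
  by apply: degB; rewrite -betaE.
exists (fun j : 'I_e => pmap g (pt r`_j 1)); split.
- move=> j; split.
    apply/Cg; split; first by apply: nzg; apply: pt_finite_neq0.
    exists (pt r`_j 1); first exact: pt_finite_neq0.
    exact: proj_eq_refl.
  by rewrite -combE; apply/eqP; rewrite -/(root _ _) rootr mem_nth ?sz_r.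
- move=> j j' [c nzc gj'].
  have nzj : peval (G i) (pmap g (pt r`_j 1)) != 0.
    by rewrite -badE badr // mem_nth ?sz_r.
  have := invG (pt r`_j' 1); have := invG (pt r`_j 1).
  rewrite !pt0 !pt1 !mulr1 gj' !(peval_homogZ _ _ (hG _)) => e1 e2.
  have nzG1 : peval (G 1) (pmap g (pt r`_j 1)) != 0.
    apply: contraNneq nzj => G10; case: (ord2_cases i) => -> //.
      by rewrite e1 G10 mul0r.
    by rewrite G10.
  move: e2; rewrite e1 -mulrA => /mulfI.
  rewrite expf_neq0 // => /(_ isT) /(mulfI nzG1) /eqP.
  by rewrite nth_uniq ?sz_r // => /eqP/val_inj.
move=> x [/Cg[nzx [w nzw gw]] hx].
have [c nzc xE] := gw.
have scE a (v : 'rV[K]_N) j : (a *: v) 0 j = a * v 0 j by rewrite mxE.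
have hw : \sum_j h 0 j * pmap g w 0 j = 0.
  apply: (mulfI nzc); rewrite mulr0 -[RHS]hx mulr_sumr; apply: eq_bigr => j _.
  by rewrite xE scE mulrCA.
have [w1|nzw1] := eqVneq (w 0 1) 0.
  case/eqP: nze; rewrite comb_infty; have nzw0 : w 0 0 != 0.
    by apply: contraNneq nzw => w0; rewrite (pt_infty w1) w0 scale0r.
  apply: (mulfI (expf_neq0 e nzw0)); rewrite mulr0 -[RHS]hw mulr_sumr.
  apply: eq_bigr => j _.
  by rewrite [in RHS](pt_infty w1) (pmap_scale _ _ hg) scE mulrCA.
pose z := w 0 0 / w 0 1.
have zr : z \in r.
  rewrite -rootr; apply/eqP; rewrite combE; apply: (mulfI (expf_neq0 e nzw1)).
  rewrite mulr0 -[RHS]hw mulr_sumr; apply: eq_bigr => j _.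
  by rewrite [in RHS](pt_finite nzw1) (pmap_scale _ _ hg) scE mulrCA.
have ltz : (index z r < e)%N by rewrite -sz_r index_mem.
exists (Ordinal ltz); rewrite /= nth_index //; apply: proj_eq_trans gw.
apply: (pmap_proj_eq hg); rewrite [X in proj_eq _ X](pt_finite nzw1).
exact: proj_eq_scale.
Qed.

End Degree.

(** * Toric varieties and their tori *)

Section Toric.
Variables (K : closedFieldType) (n N : nat) (A : 'I_N -> 'rV[int]_n).
Variable tau : {set 'I_N}.
Implicit Types (c b : 'I_N -> int) (t : torus K A tau).

Definition affine_relation c :=
  \sum_(i in tau) c i = 0 /\ \sum_(i in tau) A i *~ c i = 0.

Definition pos_part (z : int) : nat := if z is Posz k then k else 0%N.
Definition neg_part (z : int) : nat := if z is Negz k then k.+1 else 0%N.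

Lemma pos_neg_part z : (pos_part z)%:Z - (neg_part z)%:Z = z.
Proof. by case: z => k /=; rewrite ?subr0 // sub0r NegzE. Qed.

Lemma toric_variety_off_face (x : 'rV[K]_N) i :
  toric_variety A tau x -> i \notin tau -> x 0 i = 0.
Proof.
move=> [_ /(_ 1%N 'X_i)]; rewrite /peval mevalXU => Ix ni; apply: Ix.
  by rewrite dhomogX /= mdeg1.
move=> s; rewrite msuppX big_cons big_nil ifF //; apply/negP=> /andP[/forallP/(_ i)].
by rewrite mnm1E eqxx /= (negPf ni).
Qed.

(** An affine relation with positive part c+ and negative part c- yields the
    binomial x^(c+) - x^(c-) of the toric ideal. *)
Lemma toric_variety_binomial (x : 'rV[K]_N) c :
  toric_variety A tau x -> affine_relation c ->
  \prod_(i in tau) x 0 i ^+ pos_part (c i) =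
  \prod_(i in tau) x 0 i ^+ neg_part (c i).
Proof.
move=> [_ Ix] [c0 Ac0].
pose mon (e : int -> nat) : 'X_{1..N} :=
  [multinom (if i \in tau then e (c i) else 0%N) | i < N].
have monE e : \prod_(i in tau) x 0 i ^+ e (c i) = peval 'X_[mon e] x.
  rewrite /peval mevalX [LHS]big_mkcond; apply: eq_bigr => i _.
  by rewrite mnmE; case: ifP => // _; rewrite expr0.
have supp_mon e : supported_in tau (mon e).
  by apply/forallP=> i; rewrite mnmE; case: ifP; rewrite ?eqxx ?implybT.
have weight_mon : mweight A (mon pos_part) = mweight A (mon neg_part).
  congr pair.
    apply/eqP; rewrite -subr_eq0 -sumrB; apply/eqP.
    rewrite -[RHS]Ac0 [RHS]big_mkcond; apply: eq_bigr => i _; rewrite !mnmE.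
    case: ifP => _; last by rewrite subrr.
    by rewrite -[X in _ *~ X](pos_neg_part (c i)) mulrzBr -!pmulrn.
  rewrite !mdegE !(big_morph Posz PoszD (erefl _)); apply/eqP.
  rewrite -subr_eq0 -sumrB; apply/eqP; rewrite -[RHS]c0 [RHS]big_mkcond.
  apply: eq_bigr => i _; rewrite !mnmE; case: ifP => _; last by rewrite subr0.
  by rewrite pos_neg_part.
rewrite !monE; apply/eqP; rewrite -subr_eq0 -mevalB; apply/eqP.
apply: (Ix (mdeg (mon pos_part))) => [|s].
  rewrite rpredB ?dhomogX //=; apply/eqP.
  by have /= [->] := congr1 snd weight_mon.
have [e|ne] := eqVneq (mon pos_part) (mon neg_part).
  by rewrite e subrr msupp0 big_nil.
have supp : perm_eq (msupp ('X_[K, mon pos_part] - 'X_[mon neg_part]))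
    [:: mon pos_part; mon neg_part].
  apply: uniq_perm; rewrite ?msupp_uniq //= ?inE ?ne // => m.
  rewrite mcoeff_msupp mcoeffB !mcoeffX !inE ![_ == m]eq_sym.
  have [->|_] := eqVneq m (mon pos_part); first by rewrite (negPf ne) subr0 oner_eq0.
  by have [_|_] := eqVneq m _; rewrite sub0r oppr_eq0 ?oner_eq0 ?eqxx.
rewrite (perm_big _ supp) !big_cons big_nil !supp_mon weight_mon /=.
case: (_ == s) => //; rewrite !mcoeffB !mcoeffX !eqxx [mon neg_part == _]eq_sym.
by rewrite (negPf ne) subr0 sub0r addr0 subrr.
Qed.

Lemma in_lattice0 : in_lattice A tau 0.
Proof.
by exists (fun _ _ => 0); rewrite big1 // => i _; rewrite big1 // => j _; rewrite mulr0z.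
Qed.

Lemma in_latticeD v w :
  in_lattice A tau v -> in_lattice A tau w -> in_lattice A tau (v + w).
Proof.
case=> c -> [c' ->]; exists (fun i j => c i j + c' i j).
rewrite -big_split; apply: eq_bigr => i _; rewrite -big_split.
by apply: eq_bigr => j _; rewrite mulrzDr.
Qed.

Lemma in_latticeN v : in_lattice A tau v -> in_lattice A tau (- v).
Proof.
case=> c ->; exists (fun i j => - c i j).
rewrite -sumrN; apply: eq_bigr => i _; rewrite -sumrN.
by apply: eq_bigr => j _; rewrite mulrNz.
Qed.

Lemma in_lattice_diff i j : i \in tau -> j \in tau -> in_lattice A tau (A i - A j).
Proof.
move=> it jt; exists (fun i' j' => ((i' == i) && (j' == j))%:Z).
rewrite (bigD1 i) //= (bigD1 j) //= !eqxx mulr1z !big1 ?addr0 //.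
  move=> i' /andP[_ /negPf->]; rewrite big1 // => j' _; rewrite mulr0z //.
by move=> j' /andP[_ /negPf->]; rewrite andbF mulr0z.
Qed.

Lemma in_lattice_affine v : in_lattice A tau v ->
  exists b, \sum_(i in tau) b i = 0 /\ v = \sum_(i in tau) A i *~ b i.
Proof.
case=> c ->; exists (fun i => \sum_(j in tau) (c i j - c j i)); split.
  under eq_bigr do rewrite sumrB.
  by rewrite sumrB [X in _ - X]exchange_big subrr.
under eq_bigr do under eq_bigr do rewrite mulrzBl.
under eq_bigr do rewrite sumrB; rewrite sumrB [X in _ - X]exchange_big -sumrB.
apply: eq_bigr => i _; rewrite -sumrB mulrz_sumr; apply: eq_bigr => j _.
by rewrite mulrzBr.
Qed.

Lemma tchar0 t : t 0 = 1.
Proof.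
have nz : t 0 != 0 by apply: tchar_neq0; apply: in_lattice0.
by apply: (mulfI nz); rewrite mulr1 -tcharD ?addr0 //; apply: in_lattice0.
Qed.

Lemma tcharN t v : in_lattice A tau v -> t (- v) = (t v)^-1.
Proof.
move=> Lv; have nz : t v != 0 by apply: tchar_neq0.
apply: (mulfI nz).
by rewrite -tcharD ?subrr ?tchar0 ?mulfV //; apply: in_latticeN.
Qed.

(** The differences A i - A i0 generate the lattice of tau. *)
Lemma torus_eq_generators t t' i0 : i0 \in tau ->
  (forall i, i \in tau -> t (A i - A i0) = t' (A i - A i0)) -> torus_eq t t'.
Proof.
move=> i0t eqt v [c ->].
pose agree v := in_lattice A tau v /\ t v = t' v.
have agree0 : agree 0 by split; [apply: in_lattice0 | rewrite !tchar0].
have agreeD v1 v2 : agree v1 -> agree v2 -> agree (v1 + v2).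
  move=> [L1 e1] [L2 e2]; split; first exact: in_latticeD.
  by rewrite !tcharD // e1 e2.
have agreeN v1 : agree v1 -> agree (- v1).
  by move=> [L1 e1]; split; [apply: in_latticeN | rewrite !tcharN // e1].
have agreeM v1 z : agree v1 -> agree (v1 *~ z).
  move=> a1; elim/int_ind: z => [|k IH|k IH]; first by rewrite mulr0z.
    by rewrite intS mulrzDr mulr1z; apply: agreeD.
  by rewrite intS opprD mulrzDr mulrN1z; apply: agreeD => //; apply: agreeN.
suff [] : agree (\sum_(i in tau) \sum_(j in tau) (A i - A j) *~ c i j) by [].
apply: (big_ind agree) => // i it; apply: (big_ind agree) => // j jt.
apply: agreeM; rewrite -[A i](subrK (A i0)) -addrA -[A i0 - A j]opprB.
apply: agreeD; first by split; [apply: in_lattice_diff | apply: eqt].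
by apply: agreeN; split; [apply: in_lattice_diff | apply: eqt].
Qed.

Lemma tact_base t i0 i1 x : i0 \in tau -> i1 \in tau ->
  proj_eq (tact t i0 x) (tact t i1 x).
Proof.
move=> i0t i1t; exists (t (A i0 - A i1)).
  by apply: tchar_neq0; apply: in_lattice_diff.
apply/rowP=> i; rewrite !mxE; case: ifP => [it|_]; last by rewrite mulr0.
rewrite mulrA -tcharD; try exact: in_lattice_diff.
by congr (t _ * _); rewrite [RHS]addrC addrA subrK.
Qed.

(** A character of the lattice of tau amounts to values at the points of tau, up
    to a common factor, satisfying multiplicatively all affine relations. *)
Lemma torus_from_values (a : 'I_N -> K) :
  (forall i, i \in tau -> a i != 0) ->
  (forall c, affine_relation c -> \prod_(i in tau) a i ^ c i = 1) ->
  exists t, forall i j, i \in tau -> j \in tau -> t (A i - A j) = a i / a j.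
Proof.
move=> nza rel.
pose repr v b := \sum_(i in tau) b i = 0 /\ v = \sum_(i in tau) A i *~ b i.
pose coords v := epsilon (inhabits (fun _ : 'I_N => 0 : int)) (repr v).
have coordsP v : in_lattice A tau v -> repr v (coords v).
  by move=> /in_lattice_affine; apply: epsilon_spec.
pose val v := \prod_(i in tau) a i ^ coords v i.
have nz_prod b : \prod_(i in tau) a i ^ b i != 0.
  by apply/prodf_neq0 => i it; rewrite expfz_neq0 // nza.
have valE v b : in_lattice A tau v -> repr v b -> val v = \prod_(i in tau) a i ^ b i.
  move=> /coordsP[s e] [s' e']; apply: (mulIf (nz_prod (fun i => - b i))).
  rewrite -!big_split /= [RHS]big1 => [|i it]; last first.
    by rewrite -expfzDr ?nza // subrr expr0z.
  rewrite -[RHS](rel (fun i => coords v i - b i)).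
    by apply: eq_bigr => i it; rewrite expfzDr ?nza.
  split; first by rewrite sumrB s s' subrr.
  by under eq_bigr do rewrite mulrzBr; rewrite sumrB -e -e' subrr.
have val_neq0 v : in_lattice A tau v -> val v != 0 by move=> _; apply: nz_prod.
have valD v w : in_lattice A tau v -> in_lattice A tau w -> val (v + w) = val v * val w.
  move=> Lv Lw; have [sv ev] := coordsP v Lv; have [sw ew] := coordsP w Lw.
  rewrite (valE _ (fun i => coords v i + coords w i)); last 1 first.
  - split; first by rewrite big_split /= sv sw addr0.
    by under eq_bigr do rewrite mulrzDr; rewrite big_split /= -ev -ew.
  - by rewrite -big_split; apply: eq_bigr => i it; rewrite expfzDr ?nza.
  exact: in_latticeD.
exists (Torus val_neq0 valD) => i j it jt /=.
have sum_delta (V : zmodType) (F : 'I_N -> V) k : k \in tau ->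
    \sum_(i' in tau) F i' *~ (i' == k)%:Z = F k.
  move=> kt; rewrite (bigD1 k) //= eqxx mulr1z big1 ?addr0 // => i' /andP[_ /negPf->].
  by rewrite mulr0z.
have prod_delta k : k \in tau -> \prod_(i' in tau) a i' ^ (i' == k)%:Z = a k.
  move=> kt; rewrite (bigD1 k) //= eqxx expr1z big1 ?mulr1 // => i' /andP[_ /negPf->].
  by rewrite expr0z.
rewrite (valE _ (fun k => (k == i)%:Z - (k == j)%:Z)).
- rewrite -[in RHS](prod_delta i it) -[in RHS](prod_delta j jt) -prodfV -big_split.
  by apply: eq_bigr => k kt; rewrite expfzDr ?nza // invr_expz.
- exact: in_lattice_diff.
split.
  rewrite sumrB; under eq_bigr do rewrite -[_%:Z]intz.
  rewrite (sum_delta _ (fun=> 1)) //; under eq_bigr do rewrite -[_%:Z]intz.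
  by rewrite (sum_delta _ (fun=> 1)) ?subrr.
by under eq_bigr do rewrite mulrzBr; rewrite sumrB !sum_delta.
Qed.

End Toric.

(** * Standard forms and Cayley maps *)

Section CayleyMaps.
Variable K : closedFieldType.

Section MarkedPoints.
Variable l : nat.
Implicit Types (P Q : 'I_l.+1 -> 'rV[K]_2) (c : 'I_l.+1 -> K).

(** The representative of the point std_points c j whose wedge is exactly the
    form std_forms c j; the two differ in sign at the point at infinity. *)
Definition form_points c j : 'rV[K]_2 :=
  (if j == 0 then -1 else 1) *: std_points c j.

Lemma form_points_std c j : proj_eq (form_points c j) (std_points c j).
Proof.
by apply: proj_eq_sym; apply: proj_eq_scale; case: ifP; rewrite ?oppr_eq0 oner_eq0.
Qed.

Lemma std_formsE c j y : peval (std_forms c j) y = wedge (form_points c j) y.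
Proof.
rewrite /std_forms /form_points wedge_scalel /wedge !mxE /peval.
case: eqP => _; rewrite ?mevalB ?mevalZ !mevalXU /=; ring.
Qed.

Lemma std_points_neq0 c j : std_points c j != 0.
Proof.
apply/eqP=> /rowP e; have := e 0; have := e 1; rewrite !mxE /=.
by case: (j == 0) => /eqP; rewrite ?oner_eq0 // => _ /eqP; rewrite oner_eq0.
Qed.

Lemma form_points_neq0 c j : form_points c j != 0.
Proof.
exact: proj_eq_neq0 (proj_eq_sym (form_points_std c j)) (std_points_neq0 c j).
Qed.

Lemma form_points_inj P c : marked_points P -> normal_coords P c ->
  forall i j, proj_eq (form_points c i) (form_points c j) -> i = j.
Proof.
move=> [_ injP] [[M uM PM] _ _] i j ij; apply: injP.
rewrite -(mulmxK uM (P i)) -(mulmxK uM (P j)); apply: proj_eq_mulmx.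
apply: proj_eq_trans (PM i) _; apply: proj_eq_trans (proj_eq_sym (PM j)).
apply: proj_eq_trans (proj_eq_sym (form_points_std c i)) _.
exact: proj_eq_trans ij (form_points_std c j).
Qed.

(** A projective change of coordinates brings the first two marked points to
    (1 : 0) and (0 : 1); a diagonal one then moves the third to (1 : 1). *)
Lemma normal_coords_exist P : (0 < l)%N -> marked_points P ->
  exists c, normal_coords P c.
Proof.
move=> l_gt0 [nzP injP].
pose i1 : 'I_l.+1 := inord 1; have i1E : i1 = 1%N :> nat by rewrite inordK.
pose B : 'M[K]_2 := \matrix_(i, j) (if i == 0 then P 0 0 j else P i1 0 j).
have uB : B \in unitmx.
  rewrite unitmxE unitfE det_mx22 !mxE /=; apply/negP=> /eqP e.
  have /(wedge_eq0 (nzP i1) (nzP 0)) /injP i10 : wedge (P i1) (P 0) = 0.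
    exact: e.
  by move: i1E; rewrite i10.
have P0B : P 0 *m invmx B = pt 1 0.
  apply: (canLR (mulmxK uB)); rewrite pt_mulmx; apply: row2P;
  by rewrite !mxE /= mul1r mul0r addr0.
have P1B : P i1 *m invmx B = pt 0 1.
  apply: (canLR (mulmxK uB)); rewrite pt_mulmx; apply: row2P;
  by rewrite !mxE /= mul1r mul0r add0r.
have uB' : invmx B \in unitmx by rewrite unitmx_inv.
have indep i i' : i != i' -> wedge (P i *m invmx B) (P i' *m invmx B) != 0.
  move=> ne; rewrite wedge_mulmx mulf_neq0 //.
    by rewrite -unitfE -unitmxE.
  by apply: contraNneq ne => /(wedge_eq0 (nzP i) (nzP i')) /injP ->.
have coord1 i : i != 0 -> (P i *m invmx B) 0 1 != 0.
  move=> ne; have := indep i 0 ne; rewrite P0B /wedge pt0 pt1 mul1r mul0r subr0.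
  by [].
have coord0 i : i != i1 -> (P i *m invmx B) 0 0 != 0.
  move=> ne; have := indep i i1 ne; rewrite P1B /wedge pt0 pt1 mul0r mul1r sub0r.
  by rewrite oppr_eq0.
have [T [nzT0 nzT1 TE]] : exists T : 'rV[K]_2, [/\ T 0 0 != 0, T 0 1 != 0 &
    forall i : 'I_l.+1, i = 2%N :> nat -> P i *m invmx B = T].
  have [l_gt1|l_le1] := ltnP 1 l; last first.
    exists (pt 1 1); split; rewrite ?pt0 ?pt1 ?oner_eq0 // => i i2.
    by have := ltn_ord i; rewrite i2 ltnS ltnNge l_le1.
  have i2E : (inord 2 : 'I_l.+1) = 2%N :> nat by rewrite inordK.
  exists (P (inord 2) *m invmx B); split.
  - by apply: coord0; apply/eqP=> /(congr1 val); rewrite /= i2E i1E.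
  - by apply: coord1; apply/eqP=> /(congr1 val); rewrite /= i2E.
  by move=> i i2; congr (P _ *m _); apply: val_inj; rewrite /= i2E.
pose S : 'M[K]_2 := diag_mx (pt (T 0 0)^-1 (T 0 1)^-1).
have mulS y : y *m S = pt (y 0 0 / T 0 0) (y 0 1 / T 0 1).
  by rewrite (pt_eta y) pt_mulmx !mxE /= !mulr0n !mulr1n !mulr0 addr0 add0r.
pose M := invmx B *m S.
have uM : M \in unitmx.
  rewrite unitmx_mul uB' unitmxE unitfE det_diag big_ord_recl big_ord1 !mxE /=.
  by rewrite mulf_neq0 ?invr_eq0.
pose c i := (P i *m M) 0 0 / (P i *m M) 0 1.
exists c; split.
- exists M => // i; rewrite /M mulmxA mulS.
  have [->|ne] := eqVneq i 0.
    rewrite P0B pt0 pt1 mul0r; exists (T 0 0); first by [].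
    by apply: row2P; rewrite !mxE /= ?mulr0 // mul1r mulfV.
  have nz : (P i *m invmx B) 0 1 / T 0 1 != 0.
    by rewrite mulf_neq0 ?invr_eq0 ?coord1.
  exists ((P i *m invmx B) 0 1 / T 0 1)^-1; first by rewrite invr_eq0.
  apply: row2P; rewrite mxE (negPf ne) /= mxE ?pt0 ?pt1; last by rewrite mulVf.
  by rewrite /c /M mulmxA mulS pt0 pt1 mulrC.
- move=> i i_1; rewrite /c /M mulmxA mulS pt0 (_ : i = i1); last first.
    by apply: val_inj; rewrite /= i1E.
  by rewrite P1B pt0 !mul0r.
move=> i i_2; rewrite /c /M mulmxA mulS pt0 pt1 TE //.
by rewrite !mulfV ?divr1 ?oner_eq0.
Qed.

End MarkedPoints.

Lemma wprod_mulmx l (Q Q' : 'I_l -> 'rV[K]_2) (M : 'M[K]_2) : M \in unitmx ->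
  (forall j, proj_eq (Q j *m M) (Q' j)) ->
  forall m, exists2 u, u != 0 & forall y, wprod Q' m (y *m M) = u * wprod Q m y.
Proof.
move=> uM QM m.
have [|r rP] := @fin_all_exists _ _ (fun j r => r != 0 /\ Q' j = r *: (Q j *m M)).
  by move=> j; have [r nzr e] := QM j; exists r.
exists (\prod_j (r j * \det M) ^+ m j).
  apply/prodf_neq0 => j _; rewrite expf_neq0 // mulf_neq0 ?(proj1 (rP j)) //.
  by rewrite -unitfE -unitmxE.
move=> y; rewrite /wprod -big_split; apply: eq_bigr => j _ /=.
by rewrite (proj2 (rP j)) wedge_scalel wedge_mulmx mulrA exprMn.
Qed.

Lemma wprod_eq0 l (Q : 'I_l -> 'rV[K]_2) m y :
  wprod Q m y = 0 -> exists j, wedge (Q j) y = 0.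
Proof. by move/eqP/prodf_eq0=> [j _]; rewrite expf_eq0 => /andP[_ /eqP]; exists j. Qed.

Lemma wprod_at_point l (Q : 'I_l -> 'rV[K]_2) m j :
  Q j != 0 -> m j <> 0%N -> wprod Q m (Q j) = 0.
Proof.
move=> nzQ mj; rewrite /wprod (bigD1 j) //= (wedge_eq0 nzQ nzQ).2.
  by rewrite expr0n; case: (m j) mj => // k; rewrite mul0r.
exact: proj_eq_refl.
Qed.

Lemma generic_point l (Q : 'I_l -> 'rV[K]_2) : (forall j, Q j != 0) ->
  exists y, forall j, wedge (Q j) y != 0.
Proof.
move=> nzQ; pose v j := pt (Q j 0 1) (- Q j 0 0).
have [|w|y _ yP] := @general_hyperplane K 2 1 [seq v j | j <- enum 'I_l].
- exact: oner_neq0.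
- case/mapP=> j _ ->; apply: contraNneq (nzQ j) => /rowP e.
  have := e 0; have := e 1; rewrite !mxE /= => /eqP; rewrite oppr_eq0 => /eqP e0 e1.
  by apply/eqP/row2P; rewrite mxE.
exists y => j; have := yP (v j); rewrite map_f ?mem_enum // => /(_ isT).
by rewrite sum_ord2 pt0 pt1 mulrN.
Qed.

Section CayleyStructures.
Variables (n N : nat) (A : 'I_N -> 'rV[int]_n) (tau : {set 'I_N}).

Lemma Cayley_mapE l (p : 'I_N -> {ffun 'I_l.+1 -> nat}) c i y : i \in tau ->
  peval (Cayley_map tau p (std_forms c) i) y = wprod (form_points c) (p i) y.
Proof.
move=> it; rewrite /Cayley_map it /peval rmorph_prod; apply: eq_bigr => j _.
by rewrite rmorphXn /= -std_formsE.
Qed.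

Lemma Cayley_map_off_face l (p : 'I_N -> {ffun 'I_l.+1 -> nat})
    (f : 'I_l.+1 -> {mpoly K[2]}) i y : i \notin tau ->
  peval (Cayley_map tau p f i) y = 0.
Proof. by move=> /negPf it; rewrite /Cayley_map it /peval meval0. Qed.

Lemma std_forms_homog l (c : 'I_l.+1 -> K) j : std_forms c j \is 1.-homog.
Proof.
rewrite /std_forms; case: ifP => _; rewrite ?rpredB ?rpredZ // dhomogX /=;
by rewrite mdeg1.
Qed.

(** The point y is equal to Q j for at most one j, and some coordinate has
    exponent 0 there. *)
Lemma Cayley_no_common_zero l d (p : 'I_N -> {ffun 'I_l.+1 -> nat})
    (Q : 'I_l.+1 -> 'rV[K]_2) y :
  Cayley_structure A tau d p -> (forall j, Q j != 0) ->
  (forall i j, proj_eq (Q i) (Q j) -> i = j) -> y != 0 ->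
  exists2 i, i \in tau & wprod Q (p i) y != 0.
Proof.
move=> [_ _ _ pz] nzQ injQ nzy.
have [/existsP[j /eqP wj]|] := boolP [exists j, wedge (Q j) y == 0]; last first.
  rewrite negb_exists => /forallP nz; have [[i it _] _] := pz 0.
  by exists i => //; apply: wprod_neq0.
have [[i it pij] _] := pz j; exists i => //.
apply/prodf_neq0 => k _; have [->|nekj] := eqVneq k j; first by rewrite pij oner_neq0.
rewrite expf_neq0 //; apply: contraNneq nekj => wk; apply/eqP/injQ.
apply: proj_eq_trans (proj_eq_sym _); first exact/(wedge_eq0 (nzQ k) nzy).
exact/(wedge_eq0 (nzQ j) nzy).
Qed.

Lemma Cayley_map_morphism l d (p : 'I_N -> {ffun 'I_l.+1 -> nat})
    (P : 'I_l.+1 -> 'rV[K]_2) c :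
  Cayley_structure A tau d p -> marked_points P -> normal_coords P c ->
  P1_morphism d (Cayley_map tau p (std_forms c)).
Proof.
move=> pC markP normc; split=> [i|y nzy]; last first.
  have [i it nzi] := Cayley_no_common_zero pC (form_points_neq0 c)
    (form_points_inj markP normc) nzy.
  by apply: contraNneq nzi => /rowP/(_ i); rewrite !mxE Cayley_mapE // => ->.
rewrite /Cayley_map; case: ifP => it; last exact: dhomog0.
have [sum_p _ _ _] := pC; rewrite -(sum_p i it).
apply: (big_ind2 (fun (F : {mpoly K[2]}) k => F \is k.-homog)).
- exact: dhomog1.
- by move=> F k F' k'; apply: dhomogM.
move=> j _; have := dhomogMn (p i j) (std_forms_homog c j); by rewrite mul1n.
Qed.

(** Along a curve in the toric variety, the monomial identities coming from
    affine relations split into the identities for the zero orders at each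
    point and the one for the leading constants. *)
Lemma toric_curve_relations l (Q : 'I_l -> 'rV[K]_2) (m : 'I_N -> 'I_l -> nat)
    (a : 'I_N -> K) (x : 'rV[K]_2 -> 'rV[K]_N) :
  (forall j, Q j != 0) -> (forall i j, proj_eq (Q i) (Q j) -> i = j) ->
  (forall i, i \in tau -> a i != 0) ->
  (forall y, y != 0 -> toric_variety A tau (x y)) ->
  (forall i y, i \in tau -> x y 0 i = a i * wprod Q (m i) y) ->
  forall c, affine_relation A tau c ->
    (forall j, \sum_(i in tau) c i * (m i j)%:Z = 0) /\
    \prod_(i in tau) a i ^ c i = 1.
Proof.
move=> nzQ injQ nza toric_x xE c rel_c.
pose lead (e : int -> nat) := \prod_(i in tau) a i ^+ e (c i).
pose expo (e : int -> nat) j := (\sum_(i in tau) m i j * e (c i))%N.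
have nz_lead e : lead e != 0.
  by apply/prodf_neq0 => i it; rewrite expf_neq0 ?nza.
have monE e y : \prod_(i in tau) x y 0 i ^+ e (c i) = lead e * wprod Q (expo e) y.
  rewrite -wprod_prod -big_split; apply: eq_bigr => i it /=.
  by rewrite xE // exprMn wprod_expr.
have binom y : y != 0 -> lead pos_part * wprod Q (expo pos_part) y =
    lead neg_part * wprod Q (expo neg_part) y.
  by move=> nzy; rewrite -!monE; apply: toric_variety_binomial rel_c; apply: toric_x.
have eq_expo := wprod_uniq nzQ injQ (nz_lead _) (nz_lead _) binom.
have eq_lead : lead pos_part = lead neg_part.
  have [|y yP] := @generic_point l.+1 (fun j => oapp Q (pt 0 1) (unlift 0 j)).
    by move=> j; case: unlift => [j'|] //=; apply: pt_finite_neq0.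
  have nzy : y != 0.
    have := yP 0; rewrite unlift_none /=; apply: contraNneq => ->.
    by rewrite /wedge !mxE !mul0r subrr.
  have nzw : wprod Q (expo pos_part) y != 0.
    by apply: wprod_neq0 => j; have := yP (lift 0 j); rewrite liftK.
  apply: (mulIf nzw); rewrite binom //; congr (_ * _).
  by apply: eq_bigr => j _; rewrite eq_expo.
split=> [j|].
  have /eqP := congr1 Posz (eq_expo j).
  rewrite /expo !(big_morph Posz PoszD (erefl _)) -subr_eq0 -sumrB => /eqP e0.
  rewrite -[RHS]e0; apply: eq_bigr => i it.
  by rewrite !PoszM -mulrBr pos_neg_part mulrC.
have -> : \prod_(i in tau) a i ^ c i = lead pos_part / lead neg_part.
  rewrite /lead -prodfV -big_split; apply: eq_bigr => i it /=.
  by rewrite -[c i in LHS]pos_neg_part expfzDr ?nza // -invr_expz.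
by rewrite eq_lead mulfV.
Qed.

End CayleyStructures.
End CayleyMaps.

(** * Cayley presentations *)

Section Closure.
Variables (K : closedFieldType) (N : nat).
Implicit Types (C S : pset K N).

Lemma psubset_closure S x : x != 0 -> S x -> pclosure S x.
Proof. by move=> nzx Sx; split=> // k F _; apply. Qed.

Lemma pclosure_closed C : pclosed C -> pset_eq (pclosure C) C.
Proof.
move=> [I CI] x; split=> [[nzx vx]|Cx].
  apply/CI; split=> // k F hF IF; apply: (vx k) => // z /CI[_ vz]; exact: (vz k).
by apply: psubset_closure => //; have /CI[] := Cx.
Qed.

Lemma zero_locus_proj (I : {mpoly K[N]} -> Prop) x y :
  proj_eq x y -> zero_locus I x -> zero_locus I y.
Proof.
move=> exy [nzx vx]; split; first exact: proj_eq_neq0 exy nzx.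
by case: exy => a _ -> k F hF IF; rewrite (peval_homogZ _ _ hF) (vx k) ?mulr0.
Qed.

Lemma pclosed_proj C x y : pclosed C -> proj_eq x y -> C x -> C y.
Proof. by move=> [I CI] exy /CI/(zero_locus_proj exy)/CI. Qed.

Lemma pclosure_eq S S' : pset_eq S S' -> pset_eq (pclosure S) (pclosure S').
Proof.
by move=> e x; split=> -[nzx vx]; split=> // k F hF v; apply: (vx k) => // z /e/v.
Qed.

Lemma pimage_pmap e (g : 'I_N -> {mpoly K[2]}) y :
  P1_morphism e g -> y != 0 -> pimage g (pmap g y).
Proof.
by move=> [_ nzg] nzy; split; [apply: nzg | exists y => //; apply: proj_eq_refl].
Qed.

End Closure.

Section TorusTranslates.
Variables (K : closedFieldType) (n N : nat) (A : 'I_N -> 'rV[int]_n).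
Variables (tau : {set 'I_N}) (C : pset K N) (d : nat) (g : 'I_N -> {mpoly K[2]}).
Hypotheses (closedC : pclosed C) (morg : P1_morphism d g) (birg : birational_onto_image g).
Hypothesis (Cg : pset_eq C (pimage g)).

(** If C is a torus translate of the closure of the image of h, then t h
    parametrizes a dense part of C, so the rational inverse of g does not vanish
    on it identically and birational_lift applies. *)
Lemma translate_lift (t : torus K A tau) (h : 'I_N -> {mpoly K[2]}) i0 :
  i0 \in tau -> P1_morphism d h ->
  (forall i y, i \notin tau -> peval (h i) y = 0) ->
  pset_eq C (tact_set t (pclosure (pimage h))) ->
  exists (M : 'M[K]_2) (r : K), [/\ M \in unitmx, r != 0 &
    forall y i, i \in tau ->
      t (A i - A i0) * peval (h i) y = r * peval (g i) (y *m M)].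
Proof.
move=> i0t morh h_off Ct; have [hh nzh] := morh; have [hg nzg] := morg.
have d_gt0 := birational_degree_gt0 hg birg.
have [k [G [hG [yG [nzyG [iG nzG]]] invG]]] := birg.
pose w i := if i \in tau then t (A i - A i0) else 0.
have tactE x : tact t i0 x = \row_i (w i * x 0 i).
  by apply/rowP=> i; rewrite !mxE /w; case: ifP; rewrite ?mul0r.
pose phi i := w i *: h i.
have phiE y : pmap phi y = tact t i0 (pmap h y).
  by rewrite tactE; apply/rowP=> i; rewrite !mxE /peval mevalZ.
have morphi : P1_morphism d phi.
  split=> [i|y nzy]; first by apply: rpredZ.
  have [i nzi] := row_neq0P (nzh y nzy).
  have it : i \in tau by apply: contraNT nzi => it; rewrite mxE h_off.
  apply: contraNneq nzi => /rowP/(_ i)/eqP; rewrite phiE tactE !mxE /w it.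
  by rewrite mulf_eq0 (negPf (tchar_neq0 _ (in_lattice_diff _ it i0t))).
have phiC y : y != 0 -> C (pmap phi y).
  move=> nzy; apply/Ct; exists i0, (pmap h y); split=> //.
    by apply: psubset_closure; [apply: nzh | apply: pimage_pmap nzy].
  by rewrite phiE; apply: proj_eq_refl.
have [||M [r [uM nzr phi_g]]] := birational_lift d_gt0 morg hG invG morphi.
- by move=> y /phiC/Cg[].
- apply: NNPP => vanish; case/negP: nzG; apply/eqP.
  have /Ct[i1 [x [i1t [_ clx] xE]]] : C (pmap g yG) by apply/Cg; apply: pimage_pmap nzyG.
  have {xE}[a nza ->] := proj_eq_trans (tact_base t x i0t i1t) xE.
  rewrite (peval_homogZ _ _ (hG iG)) tactE.
  have [F hF FE] := homog_diag_subst w (hG iG); rewrite -FE (clx k F hF) ?mulr0 //.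
  move=> z [_ [y nzy [b nzb ->]]]; rewrite (peval_homogZ _ _ hF) FE -tactE -phiE.
  have [->|nz] := eqVneq (peval (G iG) (pmap phi y)) 0; first by rewrite mulr0.
  by case: vanish; exists y, iG.
exists M, r; split=> // y i it.
by have /rowP/(_ i) := phi_g y; rewrite phiE tactE !mxE /w it.
Qed.

Lemma presentation_lift l (p : 'I_N -> {ffun 'I_l.+1 -> nat})
    (P : 'I_l.+1 -> 'rV[K]_2) (t : torus K A tau) i0 :
  i0 \in tau -> Cayley_presentation C d p P t ->
  exists c (M : 'M[K]_2) (r : K), [/\ normal_coords P c, M \in unitmx, r != 0 &
    forall y i, i \in tau -> t (A i - A i0) * wprod (form_points c) (p i) y =
      r * peval (g i) (y *m M)].
Proof.
move=> i0t [pC markP [c normc Ct]].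
have [|M [r [uM nzr eM]]] := translate_lift i0t (Cayley_map_morphism pC markP normc) _ Ct.
  exact: Cayley_map_off_face.
by exists c, M, r; split=> // y i it; rewrite -eM // Cayley_mapE.
Qed.

End TorusTranslates.

Section PointTransfer.
Variables (K : closedFieldType) (n N : nat) (A : 'I_N -> 'rV[int]_n).
Variables (tau : {set 'I_N}) (d : nat).

(** The marked points of a Cayley curve are the zeros of its coordinates, so a
    coordinate change relating two Cayley parametrizations matches them. *)
Lemma point_transfer l l' (p : 'I_N -> {ffun 'I_l.+1 -> nat})
    (p' : 'I_N -> {ffun 'I_l'.+1 -> nat})
    (Q : 'I_l.+1 -> 'rV[K]_2) (Q' : 'I_l'.+1 -> 'rV[K]_2) (M : 'M[K]_2)
    (nu : 'I_N -> K) :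
  Cayley_structure A tau d p' -> M \in unitmx ->
  (forall j, Q j != 0) -> (forall j, Q' j != 0) ->
  (forall i, i \in tau -> nu i != 0) ->
  (forall y i, i \in tau -> wprod Q' (p' i) y = nu i * wprod Q (p i) (y *m M)) ->
  exists s : 'I_l'.+1 -> 'I_l.+1, forall j, proj_eq (Q' j *m M) (Q (s j)).
Proof.
move=> [_ _ _ pz] uM nzQ nzQ' nznu e.
apply: (@fin_all_exists _ _ (fun j k => proj_eq (Q' j *m M) (Q k))) => j.
have [_ [i it pij]] := pz j.
have := e (Q' j) i it; rewrite wprod_at_point // => /esym/eqP.
rewrite mulf_eq0 (negPf (nznu i it)) => /eqP/wprod_eq0[k wk]; exists k.
by apply/proj_eq_sym/(wedge_eq0 (nzQ k) (mulmx_neq0 uM (nzQ' j))).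
Qed.

Lemma point_transfer_inj l l' (Q : 'I_l.+1 -> 'rV[K]_2) (Q' : 'I_l'.+1 -> 'rV[K]_2)
    (M : 'M[K]_2) (s : 'I_l'.+1 -> 'I_l.+1) : M \in unitmx ->
  (forall i j, proj_eq (Q' i) (Q' j) -> i = j) ->
  (forall j, proj_eq (Q' j *m M) (Q (s j))) -> injective s.
Proof.
move=> uM injQ' sP i j eqs; apply: injQ'.
rewrite -(mulmxK uM (Q' i)) -(mulmxK uM (Q' j)); apply: proj_eq_mulmx.
by apply: proj_eq_trans (sP i) _; rewrite eqs; apply: proj_eq_sym.
Qed.

(** The third vector is the sum of the first two, and their images under M are
    linearly independent; so the three factors of proportionality coincide. *)
Lemma three_points (M M' : 'M[K]_2) : M \in unitmx ->
  proj_eq (pt 1 0 *m M) (pt 1 0 *m M') -> proj_eq (pt 0 1 *m M) (pt 0 1 *m M') ->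
  proj_eq (pt 1 1 *m M) (pt 1 1 *m M') -> exists2 r, r != 0 & M' = r *: M.
Proof.
move=> uM [a nza ea] [b nzb eb] [r nzr er].
have e3 : (a - r) *: (pt 1 0 *m M) + (b - r) *: (pt 0 1 *m M) = 0.
  have pt11 : pt 1 1 = pt 1 0 + pt 0 1 :> 'rV[K]_2.
    by apply: row2P; rewrite !mxE /= ?addr0 ?add0r.
  have : pt 1 1 *m M' = a *: (pt 1 0 *m M) + b *: (pt 0 1 *m M).
    by rewrite pt11 mulmxDl ea eb.
  rewrite er pt11 mulmxDl scalerDr => e.
  rewrite !scalerBl addrACA -e -opprD; apply: subrr.
have ptE : pt (a - r) (b - r) = (a - r) *: pt 1 0 + (b - r) *: pt 0 1.
  by apply: row2P; rewrite !mxE /= !mulr0 !mulr1 ?addr0 ?add0r.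
have /rowP e4 : pt (a - r) (b - r) = 0.
  by apply: (can_inj (mulmxK uM)); rewrite mul0mx ptE mulmxDl -!scalemxAl.
have ar : a = r by have := e4 0; rewrite !mxE /= => /eqP; rewrite subr_eq0 => /eqP.
have br : b = r by have := e4 1; rewrite !mxE /= => /eqP; rewrite subr_eq0 => /eqP.
exists r => //; apply/row_matrixP=> i; rewrite !rowE -scalemxAr.
case: (ord2_cases i) => ->.
  have -> : delta_mx 0 0 = pt 1 0 :> 'rV[K]_2 by apply: row2P; rewrite !mxE.
  by rewrite ea ar.
have -> : delta_mx 0 1 = pt 0 1 :> 'rV[K]_2 by apply: row2P; rewrite !mxE.
by rewrite eb br.
Qed.

End PointTransfer.

(** It suffices to choose one object for each label in use. *)
Lemma finitely_many_labelled (S : finType) (T : Type) (lab : S -> T -> Prop)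
    (E : T -> T -> Prop) (good : T -> Prop) (t0 : T) :
  (forall t, good t -> exists s, lab s t) ->
  (forall s t t', lab s t -> lab s t' -> E t t') ->
  exists (m : nat) (ts : 'I_m -> T), forall t, good t -> exists k, E t (ts k).
Proof.
move=> labelled uniq_lab.
exists #|S|, (fun k => epsilon (inhabits t0) (lab (enum_val k))) => t /labelled[s st].
exists (enum_rank s); rewrite enum_rankK; apply: (uniq_lab s) => //.
by apply: epsilon_spec; exists t.
Qed.

Lemma sum_count_mem (T : eqType) (s : seq T) l (Q : 'I_l -> T) :
  injective Q -> (forall R, R \in s -> exists j, Q j = R) ->
  (\sum_j count_mem (Q j) s)%N = size s.
Proof.
move=> injQ; elim: s => [|R s IHs] cover; first by rewrite big1.
rewrite /= -IHs => [|R' sR']; last by apply: cover; rewrite inE sR' orbT.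
have [j <-] := cover R (mem_head _ _).
rewrite big_split (bigD1 j) //= eqxx big1 ?addn0 // => k nekj.
by rewrite (inj_eq injQ) eq_sym (negPf nekj).
Qed.

Section MainParts.
Variables (K : closedFieldType) (n N : nat) (A : 'I_N -> 'rV[int]_n).
Variables (tau : {set 'I_N}) (C : pset K N) (d : nat) (g : 'I_N -> {mpoly K[2]}).
Hypotheses (closedC : pclosed C) (morg : P1_morphism d g) (birg : birational_onto_image g).
Hypothesis (Cg : pset_eq C (pimage g)).
Hypothesis subC : psubset C (toric_variety A tau).

Let hg : forall i, g i \is d.-homog := proj1 morg.
Let nzg : forall y, y != 0 -> pmap g y != 0 := proj2 morg.
Let d_gt0 : (0 < d)%N := birational_degree_gt0 hg birg.

Lemma curve_pmap y : y != 0 -> C (pmap g y).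
Proof. by move=> nzy; apply/Cg; apply: pimage_pmap nzy. Qed.

Lemma param_off_face i y : i \notin tau -> peval (g i) y = 0.
Proof.
move=> it; have [->|nzy] := eqVneq y 0.
  rewrite -(scale0r (pt 1 0)) (peval_homogZ _ _ (hg i)) expr0n gtn_eqF ?mul0r //.
by have := toric_variety_off_face (subC (curve_pmap nzy)) it; rewrite mxE.
Qed.

Lemma face_nonempty : exists i0, i0 \in tau.
Proof.
have [i nzi] := row_neq0P (nzg (pt_infty_neq0 K)); exists i.
by apply: contraNT nzi => it; rewrite mxE param_off_face.
Qed.

(** Both presentations are lifts through g, so they differ by a projectivity M of
    P^1 and a constant nu i on each coordinate. *)
Lemma Cayley_presentation_transition l l' (p : 'I_N -> {ffun 'I_l.+1 -> nat})
    (p' : 'I_N -> {ffun 'I_l'.+1 -> nat}) P P' (t t' : torus K A tau) :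
  Cayley_presentation C d p P t -> Cayley_presentation C d p' P' t' ->
  exists c c' (M : 'M[K]_2) nu, [/\ normal_coords P c, normal_coords P' c',
    M \in unitmx, forall i, i \in tau -> nu i != 0 &
    forall y i, i \in tau -> wprod (form_points c') (p' i) y =
      nu i * wprod (form_points c) (p i) (y *m M)].
Proof.
have [i0 i0t] := face_nonempty => pres pres'.
have [c [M [r [normc uM nzr eM]]]] := presentation_lift morg birg Cg i0t pres.
have [c' [M' [r' [normc' uM' nzr' eM']]]] := presentation_lift morg birg Cg i0t pres'.
have nzt (u : torus K A tau) i : i \in tau -> u (A i - A i0) != 0.
  by move=> it; apply: tchar_neq0; apply: in_lattice_diff.
exists c, c', (M' *m invmx M), (fun i => r' / t' (A i - A i0) * (t (A i - A i0) / r)).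
split=> //.
- by rewrite unitmx_mul uM' unitmx_inv.
- by move=> i it; rewrite !mulf_neq0 ?invr_eq0 ?nzt.
move=> y i it; apply: (mulfI (nzt t' i it)); rewrite eM' //.
have := eM (y *m (M' *m invmx M)) i it; rewrite !mulmxA mulmxKV // => e.
have -> : peval (g i) (y *m M') =
    t (A i - A i0) / r * wprod (form_points c) (p i) (y *m M' *m invmx M).
  by rewrite mulrAC e mulrAC mulfV ?mul1r.
by field; rewrite nzr nzt.
Qed.

(** The projectivity maps the marked points of one presentation injectively to
    those of the other. *)
Lemma Cayley_length_le l l' (p : 'I_N -> {ffun 'I_l.+1 -> nat})
    (p' : 'I_N -> {ffun 'I_l'.+1 -> nat}) P P' (t t' : torus K A tau) :
  Cayley_presentation C d p P t -> Cayley_presentation C d p' P' t' -> (l' <= l)%N.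
Proof.
move=> pres pres'.
have [c [c' [M [nu [normc normc' uM nznu eM]]]]] := Cayley_presentation_transition pres pres'.
have [pC' markP' _] := pres'.
have [s sP] := point_transfer pC' uM (form_points_neq0 c) (form_points_neq0 c') nznu eM.
have injs := point_transfer_inj uM (form_points_inj markP' normc') sP.
by have := leq_card s injs; rewrite !card_ord.
Qed.

Lemma M0_eq_form_points l (P : 'I_l.+1 -> 'rV[K]_2) c :
  normal_coords P c -> M0_eq P (form_points c).
Proof.
move=> [[M uM PM] _ _]; exists M => // i.
exact: proj_eq_trans (PM i) (proj_eq_sym (form_points_std c i)).
Qed.

(** Once the marked points are matched, the exponents agree as orders of vanishing
    of the same coordinates. *)
Lemma Cayley_presentation_uniq l (p p' : 'I_N -> {ffun 'I_l.+1 -> nat}) P P'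
    (t t' : torus K A tau) :
  Cayley_presentation C d p P t -> Cayley_presentation C d p' P' t' ->
  exists s : 'S_l.+1, (forall i j, i \in tau -> p' i j = p i (s j)) /\
    M0_eq (fun j => P (s j)) P'.
Proof.
move=> pres pres'.
have [c [c' [M [nu [normc normc' uM nznu eM]]]]] := Cayley_presentation_transition pres pres'.
have [pC' markP' _] := pres'.
have [s sP] := point_transfer pC' uM (form_points_neq0 c) (form_points_neq0 c') nznu eM.
have injs := point_transfer_inj uM (form_points_inj markP' normc') sP.
exists (perm injs); split=> [i j it|].
  rewrite permE.
  have [u nzu uE] := wprod_mulmx (Q' := form_points c \o s) uM sP (p i \o s).
  apply: (wprod_uniq (form_points_neq0 c') (form_points_inj markP' normc')
    (c := 1) (c' := nu i * u) (m := p' i) (m' := p i \o s)); rewrite ?oner_eq0 //.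
    by rewrite mulf_neq0 ?nznu.
  move=> y _; rewrite mul1r eM // -mulrA -uE; congr (_ * _).
  by rewrite /wprod (reindex_inj injs).
have [H uH PH] := M0_eq_form_points normc.
have [H' uH' PH'] := M0_eq_form_points normc'.
exists (H *m invmx M *m invmx H'); first by rewrite !unitmx_mul !unitmx_inv uH uM.
move=> j; rewrite permE !mulmxA -[P' j](mulmxK uH'); apply: proj_eq_mulmx.
apply: proj_eq_trans (proj_eq_sym (PH' j)); rewrite -[form_points c' j](mulmxK uM).
by apply: proj_eq_mulmx; apply: proj_eq_trans (PH _) _; apply: proj_eq_sym.
Qed.

(** An element of the stabilizer of C acts on the parametrizing line by a
    projectivity that permutes the marked points. As there are at least three of
    these, the permutation determines the projectivity, hence the element. *)
Lemma stabilizer_finite l (p : 'I_N -> {ffun 'I_l.+1 -> nat}) P (t : torus K A tau) :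
  Cayley_presentation C d p P t -> (1 < l)%N ->
  exists (m : nat) (ts : 'I_m -> torus K A tau), forall t' : torus K A tau,
    pset_eq (tact_set t' C) C -> exists k, torus_eq t' (ts k).
Proof.
move=> pres l_gt1; have [i0 i0t] := face_nonempty.
have [c [M [r [normc uM nzr eM]]]] := presentation_lift morg birg Cg i0t pres.
have [pC markP _] := pres; have [_ c1 c2] := normc.
pose Q := form_points c.
have nzt (u : torus K A tau) i : i \in tau -> u (A i - A i0) != 0.
  by move=> it; apply: tchar_neq0; apply: in_lattice_diff.
pose lab (s : {ffun 'I_l.+1 -> 'I_l.+1}) (t' : torus K A tau) :=
  exists (H : 'M[K]_2) (r' : K), [/\ H \in unitmx, r' != 0,
    forall j, proj_eq (Q j *m H) (Q (s j)) &
    forall y i, i \in tau ->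
      t' (A i - A i0) * wprod Q (p i) y = r' * wprod Q (p i) (y *m H)].
apply: (@finitely_many_labelled _ _ lab _ _ t) => [t' stab|s t1 t2].
  have Ct' : pset_eq C (tact_set t' (pclosure (pimage g))).
    have clC x : pclosure (pimage g) x <-> C x.
      by rewrite -(pclosure_closed closedC x); apply: pclosure_eq => z; rewrite Cg.
    move=> z; rewrite -(stab z).
    by split=> -[i1 [x [i1t /clC Cx xz]]]; exists i1, x.
  have [M' [r' [uM' nzr' eM']]] :=
    translate_lift morg birg Cg i0t morg param_off_face Ct'.
  have uH : M *m M' *m invmx M \in unitmx by rewrite !unitmx_mul unitmx_inv uM uM'.
  have eH y i : i \in tau -> t' (A i - A i0) * wprod Q (p i) y =
      r' * wprod Q (p i) (y *m (M *m M' *m invmx M)).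
    move=> it; apply: (mulfI (nzt t i it)); rewrite mulrCA eM // mulrCA eM' //.
    rewrite [RHS]mulrCA eM // !mulmxA mulmxKV //; exact: mulrCA.
  have nznu i : i \in tau -> r' / t' (A i - A i0) != 0.
    by move=> it; rewrite mulf_neq0 ?invr_eq0 ?nzt.
  have [|s sP] := point_transfer (p := p) pC uH (form_points_neq0 c)
    (form_points_neq0 c) nznu.
    move=> y i it; apply: (mulfI (nzt t' i it)); rewrite eH //.
    by field; rewrite nzt.
  exists [ffun j => s j], (M *m M' *m invmx M), r'; split=> // j.
  by rewrite ffunE.
move=> [H1 [r1 [uH1 nzr1 sH1 e1]]] [H2 [r2 [uH2 nzr2 sH2 e2]]].
have same_image j Q0 : proj_eq (Q j) Q0 -> proj_eq (Q0 *m H1) (Q0 *m H2).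
  move=> QQ0; apply: proj_eq_trans (proj_eq_mulmx H2 QQ0).
  apply: proj_eq_trans (proj_eq_sym (sH2 j)); apply: proj_eq_trans (sH1 j).
  exact/proj_eq_mulmx/proj_eq_sym.
have std_image j Q0 : std_points c j = Q0 -> proj_eq (Q0 *m H1) (Q0 *m H2).
  by move=> <-; apply: same_image (form_points_std c j).
have i1E : (inord 1 : 'I_l.+1) = 1%N :> nat by rewrite inordK // ltnW.
have i2E : (inord 2 : 'I_l.+1) = 2%N :> nat by rewrite inordK.
have ne0 k (i : 'I_l.+1) : i = k.+1 :> nat -> (i == 0) = false.
  by move=> e; apply/negP=> /eqP i_0; rewrite i_0 in e.
have [|||nu nznu H2E] := @three_points K H1 H2 uH1.
- by apply: (std_image 0); apply: row2P; rewrite !mxE.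
- apply: (std_image (inord 1)); apply: row2P; rewrite !mxE (ne0 _ _ i1E) //=.
  exact: c1.
- apply: (std_image (inord 2)); apply: row2P; rewrite !mxE (ne0 _ _ i2E) //=.
  exact: c2.
have ratio i : i \in tau -> t2 (A i - A i0) = nu ^+ d * r2 / r1 * t1 (A i - A i0).
  move=> it; have [y yP] := generic_point (form_points_neq0 c).
  have nzw : wprod Q (p i) y != 0 by apply: wprod_neq0.
  apply: (mulIf nzw); rewrite -[RHS]mulrA e1 // e2 // H2E -scalemxAr.
  rewrite -/Q.
  have -> z : wprod Q (p i) (nu *: z) = nu ^+ d * wprod Q (p i) z.
    rewrite /wprod; under eq_bigr do rewrite wedge_scale exprMn.
    rewrite big_split prodrXr /=; have [sum_p _ _ _] := pC.
    by rewrite sum_p.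
  rewrite mulrA [RHS]mulrA -[in RHS](mulrA (nu ^+ d * r2)) mulVf // mulr1.
  by rewrite [r2 * _]mulrC.
apply: (torus_eq_generators i0t) => i it; rewrite ratio //.
by have := ratio i0 i0t; rewrite subrr !tchar0 mulr1 => <-; rewrite mul1r.
Qed.

(** The marked points are all the zeros of the coordinates g i, and the Cayley
    structure records their multiplicities. *)
Lemma param_factorization :
  (forall i, i \in tau -> exists y, peval (g i) y != 0) ->
  exists l (p : 'I_N -> {ffun 'I_l.+1 -> nat}) (Q : 'I_l.+1 -> 'rV[K]_2)
      (a : 'I_N -> K),
    [/\ marked_points Q, forall i, i \in tau -> a i != 0,
        forall i, i \in tau -> (\sum_j p i j)%N = d,
        forall j, exists2 i, i \in tau & p i j <> 0%N &
        forall i y, i \in tau -> peval (g i) y = a i * wprod Q (p i) y].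
Proof.
move=> nzgi.
have [s sP] : exists s : 'I_N -> seq 'rV[K]_2, forall i, i \in tau ->
    exists a, [/\ size (s i) = d, forall Q, Q \in s i -> normalized Q, a != 0 &
      forall y, peval (g i) y = a * \prod_(Q <- s i) wedge Q y].
  apply: (@fin_all_exists _ _ (fun i s => i \in tau -> exists a,
    [/\ size s = d, forall Q, Q \in s -> normalized Q, a != 0 &
      forall y, peval (g i) y = a * \prod_(Q <- s) wedge Q y])) => i.
  have [it|_] := boolP (i \in tau); last by exists [::].
  by have [s sP] := binary_form_factor (hg i) (nzgi i it); exists s.
have [a aP] : exists a : 'I_N -> K, forall i, i \in tau -> a i != 0 /\
    forall y, peval (g i) y = a i * \prod_(Q <- s i) wedge Q y.
  apply: (@fin_all_exists _ _ (fun i a => i \in tau -> a != 0 /\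
    forall y, peval (g i) y = a * \prod_(Q <- s i) wedge Q y)) => i.
  have [/sP[a [_ _ nza aE]]|_] := boolP (i \in tau); first by exists a.
  by exists 0.
pose Z := undup (flatten [seq s i | i <- enum tau]).
have memZ Q : (Q \in Z) = [exists i in tau, Q \in s i].
  rewrite mem_undup; apply/flatten_mapP/exists_inP => -[i it Qi]; exists i => //;
  by rewrite mem_enum in it *.
have normZ Q : Q \in Z -> normalized Q.
  by rewrite memZ => /exists_inP[i /sP[b [_ norm _ _]]]; apply: norm.
have [i0 i0t] := face_nonempty; have [a0 [sz0 _ _ _]] := sP i0 i0t.
have [l szZ] : exists l, size Z = l.+1.
  case eZ: Z => [|z Z']; last by exists (size Z').
  have : s i0 =i [::].
    move=> Q; apply/negP=> Qs; have : Q \in Z by rewrite memZ; apply/exists_inP; exists i0.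
    by rewrite eZ.
  by case: (s i0) sz0 => [e|Q s' _ /(_ Q)]; [move: d_gt0; rewrite -e | rewrite mem_head].
pose Q (j : 'I_l.+1) := Z`_j.
have QZ j : Q j \in Z by rewrite mem_nth ?szZ.
have injQ : injective Q.
  by move=> i j /eqP; rewrite nth_uniq ?szZ ?undup_uniq // => /eqP/val_inj.
have cover i : i \in tau -> forall R, R \in s i -> exists j, Q j = R.
  move=> it R Rs; have RZ : R \in Z by rewrite memZ; apply/exists_inP; exists i.
  have ltR : (index R Z < l.+1)%N by rewrite -szZ index_mem.
  by exists (Ordinal ltR); rewrite /Q /= nth_index.
exists l, (fun i => [ffun j => count_mem (Q j) (s i)]), Q, a; split.
- split=> [j|i j ij]; first exact/normalized_neq0/normZ.
  by apply/injQ/normalized_inj; rewrite ?normZ.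
- by move=> i /aP[].
- move=> i it; under eq_bigr do rewrite ffunE.
  by rewrite sum_count_mem //; [have [b []] := sP i it | apply: cover].
- move=> j; have := QZ j; rewrite memZ => /exists_inP[i it Qs]; exists i => //.
  by rewrite ffunE; apply/eqP; rewrite -lt0n -has_count has_pred1.
move=> i y it; have [_ ->] := aP i it; rewrite (prod_wedge_count _ injQ (cover i it)).
by congr (_ * _); apply: eq_bigr => j _; rewrite ffunE.
Qed.

(** After a change of coordinates on P^1 normalizing the zeros P of the g i, each
    g i is a constant b i times the corresponding coordinate of the Cayley map;
    the relations between the b i make them a torus element. *)
Lemma Cayley_presentation_exists :
  (forall i, i \in tau -> exists y, peval (g i) y != 0) ->
  exists l (p : 'I_N -> {ffun 'I_l.+1 -> nat}) (P : 'I_l.+1 -> 'rV[K]_2)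
      (t : torus K A tau), Cayley_presentation C d p P t.
Proof.
move=> /param_factorization[l [p [P [a [markP nza sum_p p_pos gE]]]]].
have [nzP injP] := markP; have [i0 i0t] := face_nonempty.
have p_zero j : exists2 i, i \in tau & p i j = 0%N.
  have [i nzi] := row_neq0P (nzg (nzP j)); rewrite mxE in nzi.
  have it : i \in tau by apply: contraNT nzi => it; rewrite param_off_face.
  exists i => //; case e: (p i j) => [//|k]; case/eqP: nzi.
  by rewrite gE // wprod_at_point ?mulr0 ?e.
have toricg y : y != 0 -> toric_variety A tau (pmap g y).
  by move=> nzy; apply/subC/curve_pmap.
have pC : Cayley_structure A tau d p.
  split=> [//|c c0 Ac0 j||j]; last by split; [apply: p_zero | apply: p_pos].
    have gE' i y : i \in tau -> pmap g y 0 i = a i * wprod P (p i) y.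
      by move=> it; rewrite mxE gE.
    by have [rel _] := toric_curve_relations nzP injP nza toricg gE' (conj c0 Ac0).
  have [[i it pi] [i' i't pi']] := (p_zero 0, p_pos 0).
  by exists i, i'; split=> // e; apply: pi'; rewrite -e.
have l_gt0 : (0 < l)%N.
  rewrite lt0n; apply/eqP=> l0; have [i it pi] := p_zero 0.
  have := sum_p i it; rewrite big1 => [d0|j _]; first by move: d_gt0; rewrite -d0.
  rewrite (_ : j = 0) //; apply/val_inj/eqP.
  by have := leq_ord j; rewrite [X in (_ <= X)%N]l0 leqn0.
have [c normc] := normal_coords_exist l_gt0 markP.
have [M uM PM] := M0_eq_form_points normc.
pose Q := form_points c; pose cm := Cayley_map tau p (std_forms c).
have morcm : P1_morphism d cm := Cayley_map_morphism pC markP normc.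
have [b bP] : exists b : 'I_N -> K, forall i, i \in tau -> b i != 0 /\
    forall y, peval (g i) (y *m invmx M) = b i * wprod Q (p i) y.
  apply: (@fin_all_exists _ _ (fun i b => i \in tau -> b != 0 /\
    forall y, peval (g i) (y *m invmx M) = b * wprod Q (p i) y)) => i.
  have [it|_] := boolP (i \in tau); last by exists 0.
  have [u nzu uE] := wprod_mulmx uM PM (p i); exists (a i / u) => _.
  split=> [|y]; first by rewrite mulf_neq0 ?invr_eq0 ?nza.
  by rewrite gE // -[y in RHS](mulmxKV uM) uE mulrA divfK.
have nzb i : i \in tau -> b i != 0 by case/bP.
have uM' : invmx M \in unitmx by rewrite unitmx_inv.
have toric_gM y : y != 0 -> toric_variety A tau (pmap g (y *m invmx M)).
  by move=> nzy; apply/toricg/mulmx_neq0.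
have gME i y : i \in tau -> pmap g (y *m invmx M) 0 i = b i * wprod Q (p i) y.
  by move=> it; rewrite mxE (proj2 (bP i it)).
have [|t tE] := torus_from_values (A := A) nzb.
  move=> c' rel_c'.
  by have [] := toric_curve_relations (form_points_neq0 c)
    (form_points_inj markP normc) nzb toric_gM gME rel_c'.
exists l, p, P, t; split=> //; exists c => //.
(* The invertible diagonal map D takes the image of cm onto C; hence this image
   is closed, and D acts on it as t does, up to scalars. *)
pose w i := if i \in tau then b i else 1.
pose D (x : 'rV[K]_N) : 'rV[K]_N := \row_i (w i * x 0 i).
have nzw i : w i != 0 by rewrite /w; case: ifP => [/nzb|]; rewrite ?oner_eq0.
have DZ a' x : D (a' *: x) = a' *: D x.
  by apply/rowP=> i; rewrite !mxE mulrCA.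
have D_inj x x' : D x = D x' -> x = x'.
  by move=> e; apply/rowP=> i; apply: (mulfI (nzw i)); have /rowP/(_ i) := e; rewrite !mxE.
have D_neq0 x : x != 0 -> D x != 0.
  apply: contraNneq => Dx; apply/eqP/D_inj; rewrite Dx.
  by apply/rowP=> i; rewrite !mxE mulr0.
have Dcm y : D (pmap cm y) = pmap g (y *m invmx M).
  apply/rowP=> i; rewrite !mxE /w; case: ifPn => [it|it].
    by rewrite Cayley_mapE // (proj2 (bP i it)).
  by rewrite Cayley_map_off_face // param_off_face ?mulr0.
have image_D x : pimage cm x -> C (D x).
  move=> [nzx [y nzy [a' nza' xE]]]; rewrite xE DZ Dcm.
  apply: pclosed_proj closedC (proj_eq_scale _ nza') _.
  by apply/curve_pmap/mulmx_neq0.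
have D_image x : x != 0 -> C (D x) -> pimage cm x.
  move=> nzx /Cg[_ [y nzy [a' nza' xE]]]; split=> //; exists (y *m M).
    exact: mulmx_neq0.
  by exists a' => //; apply: D_inj; rewrite DZ Dcm mulmxK.
have closed_image x : pclosure (pimage cm) x -> pimage cm x.
  move=> [nzx vx]; apply: D_image => //; have [I CI] := closedC.
  apply/CI; split=> [|k F hF IF]; first exact: D_neq0.
  have [F' hF' F'E] := homog_diag_subst w hF; rewrite -F'E.
  apply: (vx k) => // z /image_D/CI[_ vz]; rewrite F'E; exact: (vz k).
have off_face x i : pimage cm x -> i \notin tau -> x 0 i = 0.
  by move=> [_ [y _ [a' _ ->]]] it; rewrite !mxE Cayley_map_off_face ?mulr0.
have tact_D i1 x : i1 \in tau -> pimage cm x -> proj_eq (tact t i1 x) (D x).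
  move=> i1t imx; exists (b i1); first exact: nzb.
  apply/rowP=> i; rewrite !mxE /w; case: ifPn => [it|it]; last first.
    by rewrite (off_face x i imx it) !mulr0.
  by rewrite tE // mulrA mulrCA mulfV ?mulr1 ?nzb.
move=> z; split=> [Cz|[i1 [x [i1t /closed_image imx xz]]]].
  have [nzz [y nzy gz]] := (Cg z).1 Cz; exists i0, (pmap cm (y *m M)).
  have imy : pimage cm (pmap cm (y *m M)).
    by apply: pimage_pmap morcm _; apply: mulmx_neq0.
  split=> //; first by apply: psubset_closure => //; case: imy.
  by apply: proj_eq_trans (tact_D _ _ i0t imy) _; rewrite Dcm mulmxK.
apply: pclosed_proj closedC _ (image_D x imx).
exact: proj_eq_trans (proj_eq_sym (tact_D _ _ i1t imx)) xz.
Qed.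

End MainParts.

Theorem proposition3p2p1 (K : closedFieldType) (charK : [pchar K] =i pred0)
  (R : realFieldType) (n N : nat) (A : 'I_N -> 'rV[int]_n) (injA : injective A)
  (tau : {set 'I_N}) (face_tau : is_face R A tau)
  (C : pset K N) (d : nat)
  (ratC : rational_curve C) (degC : curve_degree C d)
  (subC : psubset C (toric_variety A tau))
  (orbC : exists x, C x /\ dense_orbit A tau x) :
  [/\ exists (l : nat) (p : 'I_N -> {ffun 'I_l.+1 -> nat})
             (P : 'I_l.+1 -> 'rV[K]_2) (t : torus K A tau),
        Cayley_presentation C d p P t,
      (forall (l l' : nat)
              (p : 'I_N -> {ffun 'I_l.+1 -> nat})
              (p' : 'I_N -> {ffun 'I_l'.+1 -> nat})
              (P : 'I_l.+1 -> 'rV[K]_2) (P' : 'I_l'.+1 -> 'rV[K]_2)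
              (t t' : torus K A tau),
         Cayley_presentation C d p P t -> Cayley_presentation C d p' P' t' ->
         l = l') /\
      (forall (l : nat) (p p' : 'I_N -> {ffun 'I_l.+1 -> nat})
              (P P' : 'I_l.+1 -> 'rV[K]_2) (t t' : torus K A tau),
         Cayley_presentation C d p P t -> Cayley_presentation C d p' P' t' ->
         exists s : 'S_l.+1,
           (forall i j, i \in tau -> p' i j = p i (s j)) /\
           M0_eq (fun j => P (s j)) P') &
      forall (l : nat) (p : 'I_N -> {ffun 'I_l.+1 -> nat})
             (P : 'I_l.+1 -> 'rV[K]_2) (t : torus K A tau),
        Cayley_presentation C d p P t -> (1 < l)%N ->
        exists (m : nat) (ts : 'I_m -> torus K A tau),
          forall t' : torus K A tau,
            pset_eq (tact_set t' C) C -> exists k, torus_eq t' (ts k)].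
Proof.
have [[closedC _ _ _] [e [g [morg Cg birg]]]] := ratC.
have de : d = e := curve_degree_parametrized charK morg birg Cg degC.
rewrite -de in morg; split; [|split|].
- apply: (Cayley_presentation_exists closedC morg birg Cg subC) => i it.
  have [x [/Cg[_ [y _ [a nza xE]]] [_ nzx]]] := orbC.
  by exists y; move: (nzx i it); rewrite xE !mxE mulf_eq0 => /norP[].
- move=> l l' p p' P P' t t' pres pres'; apply/eqP; rewrite eqn_leq.
  by rewrite (Cayley_length_le morg birg Cg subC pres pres')
             (Cayley_length_le morg birg Cg subC pres' pres).
- move=> l p p' P P' t t' pres pres'.
  exact: (Cayley_presentation_uniq morg birg Cg subC pres pres').
move=> l p P t pres l_gt1.
exact: (stabilizer_finite closedC morg birg Cg subC pres l_gt1).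
Qed.
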